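(* $\mathsf{WRP}$ is a proper subclass of the word-to-word maps computable in deterministic logspace: every $\mathsf{WRP}$ map is computable in deterministic logarithmic space, and there exists a word-to-word map computable in deterministic logarithmic space that is not a $\mathsf{WRP}$ map.
   Context: **MSO on words.** A word $w=a_1\cdots a_n$ over a finite alphabet $\Sigma$ is a structure with universe $\mathrm{Pos}(w)=\{1,\dots,n\}$, the order $<$, and unary predicates $P_a$ ($a\in\Sigma$) with $P_a(i)$ iff $a_i=a$. MSO formulas are built from $x<y$, $x=y$, $P_a(x)$, $x\in X$ by Boolean connectives and quantification over positions and over sets of positions. $w\models\varphi(i_1,\dots,i_k)$ denotes satisfaction. **Polyregular presentations.** A polyregular presentation (input alphabet $\Sigma$, output alphabet $\Gamma$, both finite) consists of: a nonempty finite set $C$ of copy names, each $c\in C$ with an arity $k_c\ge1$; an MSO domain sentence $\varphi_{\mathrm{dom}}$; for each $c$ an MSO selection formula $\varphi_c(x_1,\dots,x_{k_c})$, giving the set of selected atoms $\mathrm{At}(w)=\{(c,\bar i):c\in C,\ \bar i\in\mathrm{Pos}(w)^{k_c},\ w\models\varphi_c(\bar i)\}$; for each $c$ and $\gamma\in\Gamma$ an MSO label formula $\psi_{c,\gamma}(x_1,\dots,x_{k_c})$ such that each selected atom $(c,\bar i)$ satisfies exactly one of them, that $\gamma$ being its label; and for each pair $c,c'\in C$ an MSO ordering formula $\chi_{c,c'}(\bar x,\bar y)$, such that on each $w$ these define a strict linear order $\chi$ on $\mathrm{At}(w)$. **Rank functions.** A $d$-dimensional deterministic additive rank source over $\Sigma$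 is $A=(Q,q_0,\delta,\omega)$ with $Q$ a finite set, $q_0\in Q$, $\delta\colon Q\times\Sigma\to Q$, $\omega\colon Q\times\Sigma\to\mathbb Z^d$. On $w=a_1\cdots a_n$ put $q_i=\delta(q_{i-1},a_i)$; for $1\le i\le n+1$ the prefix rank is $\rho_A^w(i)=\sum_{j<i}\omega(q_{j-1},a_j)$, and $q^A_i:=q_{i-1}$ is the state just before position $i$. A $d$-dimensional prefix-additive rank function on $k$-tuples of positions is a function of the form $\kappa^w(x_1,\dots,x_k)=c_0+\sum_{r=1}^k\bigl(\rho_{A_r}^w(x_r)+\beta_r(q^{A_r}_{x_r},a_{x_r})\bigr)$, with $c_0\in\mathbb Z^d$ fixed, $A_r$ fixed $d$-dimensional rank sources with state sets $Q_r$, and $\beta_r\colon Q_r\times\Sigma\to\mathbb Z^d$ fixed tables. **WRP.** A $\mathsf{WRP}$ presentation is a polyregular presentation together with a fixed $d\ge0$ and, for each $c\in C$, a $d$-dimensional prefix-additive rank function $\kappa_c$ on $k_c$-tuples. Selected atoms are ordered by $(c,\bar i)\prec(c',\bar i')$ iff $\kappa_c^w(\bar i)<_{\mathrm{lex}}\kappa_{c'}^w(\bar i')$, or these vectors are equal and $(c,\bar i)$ precedes $(c',\bar i')$ in $\chi$. The associated partial map $T\colon\Sigma^*\rightharpoonup\Gamma^*$ has domain $\{w:w\models\varphi_{\mathrm{dom}}\}$, and $T(w)$ is the concatenation of the labels of the selected atoms in increasing $\prec$-order. $\mathsf{WRP}$ is the class of partial maps so obtained. **Logspace.** A (partial) map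 $T\colon\Sigma^*\rightharpoonup\Gamma^*$, with $\Sigma,\Gamma$ finite alphabets, is computable in deterministic logspace if some deterministic algorithm with read-only access to the input, a write-only output, and $O(\log n)$ bits of work memory on inputs of length $n$ (with $\log n$ replaced by $\max(1,\log n)$ for small $n$) halts with output $T(w)$ on each $w\in\operatorname{dom}(T)$, and reports ''undefined'' on each $w\notin\operatorname{dom}(T)$. *)

(* Defs.v *)
From HB Require Import structures.
From mathcomp Require Import all_boot all_order all_algebra.
Set Implicit Arguments.
Unset Strict Implicit.
Unset Printing Implicit Defensive.
Import Order.TTheory GRing.Theory Num.Theory.

(* Partial maps Sigma^* -> Gamma^* are functions seq Sigma -> option (seq Gamma),
   None meaning "undefined".  Positions of w are numbered from 0: the i-th
   letter of a_1 ... a_n is the ordinal i - 1. *)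
Definition pos (Sigma : Type) (w : seq Sigma) : finType := 'I_(size w).

Definition letter (Sigma : Type) (w : seq Sigma) (i : pos w) : Sigma :=
  tnth (in_tuple w) i.

(** * MSO on words *)

(* [mso Sigma k m]: formulas whose free variables are among k position
   variables and m set variables.  A quantifier binds the variable of index 0
   of its body and shifts the other ones; the remaining connectives and the
   universal quantifiers are the usual abbreviations. *)
Inductive mso (Sigma : Type) (k m : nat) : Type :=
| MLt of 'I_k & 'I_k
| MEq of 'I_k & 'I_k
| MLetter of Sigma & 'I_k
| MIn of 'I_k & 'I_m
| MNot of mso Sigma k m
| MAnd of mso Sigma k m & mso Sigma k m
| MExPos of mso Sigma k.+1 m
| MExSet of mso Sigma k m.+1.

Definition env_cons (T : Type) (k : nat) (a : T) (e : 'I_k -> T) :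
    'I_k.+1 -> T :=
  fun i => oapp e a (unlift ord0 i).

Definition env_cat (T : Type) (k l : nat) (e : 'I_k -> T) (f : 'I_l -> T) :
    'I_(k + l) -> T :=
  fun i => match split i with inl j => e j | inr j => f j end.

Fixpoint sat (Sigma : eqType) (w : seq Sigma) (k m : nat)
    (phi : mso Sigma k m) (x : 'I_k -> pos w) (X : 'I_m -> {set pos w}) : bool :=
  match phi with
  | MLt i j => (x i < x j)%N
  | MEq i j => x i == x j
  | MLetter a i => letter (x i) == a
  | MIn i j => x i \in X j
  | MNot f => ~~ sat f x X
  | MAnd f g => sat f x X && sat g x X
  | MExPos f => [exists p : pos w, sat f (env_cons p x) X]
  | MExSet f => [exists A : {set pos w}, sat f x (env_cons A X)]
  end.

Definition models (Sigma : eqType) (w : seq Sigma) (k : nat)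
    (phi : mso Sigma k 0) (x : 'I_k -> pos w) : bool :=
  sat phi x (fun=> set0).

(* The assignment [widen_ord _ : 'I_0 -> pos w] is the empty one. *)
Definition models_sentence (Sigma : eqType) (w : seq Sigma)
    (phi : mso Sigma 0 0) : bool :=
  models phi (widen_ord (leq0n (size w)) : 'I_0 -> pos w).

(** * Polyregular presentations *)

Record polyreg_data (Sigma Gamma : finType) := PolyregData {
  copy : finType;
  arity : copy -> nat;
  dom_formula : mso Sigma 0 0;
  sel_formula : forall c : copy, mso Sigma (arity c) 0;
  lab_formula : forall c : copy, Gamma -> mso Sigma (arity c) 0;
  ord_formula : forall c c' : copy, mso Sigma (arity c + arity c') 0
}.

Definition atom (Sigma Gamma : finType) (P : polyreg_data Sigma Gamma)
    (w : seq Sigma) : finType :=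
  {c : copy P & {ffun 'I_(arity c) -> pos w}}.

Definition selected (Sigma Gamma : finType) (P : polyreg_data Sigma Gamma)
    (w : seq Sigma) : {set atom P w} :=
  [set a : atom P w | models (sel_formula (tag a)) (tagged a)].

Definition has_label (Sigma Gamma : finType) (P : polyreg_data Sigma Gamma)
    (w : seq Sigma) (a : atom P w) (g : Gamma) : bool :=
  models (lab_formula (tag a) g) (tagged a).

Definition chi (Sigma Gamma : finType) (P : polyreg_data Sigma Gamma)
    (w : seq Sigma) (a b : atom P w) : bool :=
  models (ord_formula (tag a) (tag b)) (env_cat (tagged a) (tagged b)).

Definition strict_linear_on (T : finType) (A : {set T}) (r : rel T) : Prop :=
  [/\ {in A, irreflexive r},
      {in A & &, transitive r}
    & {in A &, forall a b, a != b -> r a b || r b a}].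

Record polyreg (Sigma Gamma : finType) := Polyreg {
  polyreg_val :> polyreg_data Sigma Gamma;
  copy_nonempty : (0 < #|copy polyreg_val|)%N;
  arity_gt0 : forall c : copy polyreg_val, (0 < arity c)%N;
  label_unique : forall (w : seq Sigma) (a : atom polyreg_val w),
    a \in selected polyreg_val w -> exists! g : Gamma, has_label a g;
  chi_linear : forall w : seq Sigma,
    strict_linear_on (selected polyreg_val w) (@chi _ _ polyreg_val w)
}.

(** * Rank functions *)

Record rank_source (Sigma : finType) (d : nat) := RankSource {
  rstate : finType;
  rinit : rstate;
  rdelta : rstate -> Sigma -> rstate;
  romega : rstate -> Sigma -> 'rV[int]_d
}.

Definition state_before (Sigma : finType) (d : nat) (A : rank_source Sigma d)
    (w : seq Sigma) (i : nat) : rstate A :=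
  foldl (@rdelta _ _ A) (rinit A) (take i w).

Definition prefix_rank (Sigma : finType) (d : nat) (A : rank_source Sigma d)
    (w : seq Sigma) (i : nat) : 'rV[int]_d :=
  (\sum_(j : pos w | (j < i)%N) romega (state_before A w j) (letter j))%R.

Record rank_fun (Sigma : finType) (d k : nat) := RankFun {
  rconst : 'rV[int]_d;
  rsource : 'I_k -> rank_source Sigma d;
  rbeta : forall r : 'I_k, rstate (rsource r) -> Sigma -> 'rV[int]_d
}.

Definition rank_eval (Sigma : finType) (d k : nat) (K : rank_fun Sigma d k)
    (w : seq Sigma) (x : 'I_k -> pos w) : 'rV[int]_d :=
  (rconst K + \sum_(r < k)
     (prefix_rank (rsource K r) w (x r) +
      rbeta (state_before (rsource K r) w (x r)) (letter (x r))))%R.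

Definition lex_lt (d : nat) (u v : 'rV[int]_d) : bool :=
  [exists i : 'I_d, (u ord0 i < v ord0 i)%R &&
    [forall j : 'I_d, (j < i)%N ==> (u ord0 j == v ord0 j)]].

(** * WRP *)

Record wrp (Sigma Gamma : finType) := Wrp {
  wrp_polyreg :> polyreg Sigma Gamma;
  rank_dim : nat;
  kappa : forall c : copy wrp_polyreg, rank_fun Sigma rank_dim (arity c)
}.

Definition wrp_lt (Sigma Gamma : finType) (P : wrp Sigma Gamma)
    (w : seq Sigma) (a b : atom P w) : bool :=
  let ka := rank_eval (kappa (tag a)) (tagged a) in
  let kb := rank_eval (kappa (tag b)) (tagged b) in
  lex_lt ka kb || ((ka == kb) && chi a b).

(* [wrp_lt] is a strict linear order on the selected atoms, so sorting them by
   its reflexive closure lists them increasingly.  Since each selected atom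
   satisfies exactly one label formula, [pmap] drops nothing. *)
Definition wrp_map (Sigma Gamma : finType) (P : wrp Sigma Gamma)
    (w : seq Sigma) : option (seq Gamma) :=
  if models_sentence w (dom_formula P) then
    Some (pmap (fun a : atom P w => [pick g : Gamma | has_label a g])
            (sort (fun a b : atom P w => (a == b) || wrp_lt a b)
               (enum (selected P w))))
  else None.

Definition is_wrp (Sigma Gamma : finType)
    (T : seq Sigma -> option (seq Gamma)) : Prop :=
  exists P : wrp Sigma Gamma, T =1 wrp_map P.

(** * Deterministic logarithmic space *)

Inductive direction := GoLeft | Stay | GoRight.

(* What the input head can read: |- w -|. *)
Inductive input_symbol (Sigma : Type) : Type :=
| LeftEnd
| InputLetter of Sigma
| RightEnd.
Arguments LeftEnd {Sigma}.
Arguments RightEnd {Sigma}.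

(* Deterministic multitape Turing transducers: a two-way read-only input tape
   with endmarkers, finitely many one-way infinite read/write work tapes, and a
   one-way write-only output tape (at most one letter is appended per step). *)
Record transducer (Sigma Gamma : finType) := Transducer {
  tstate : finType;
  tstart : tstate;
  taccept : tstate;
  treject : tstate;
  taccept_reject : taccept != treject;
  work_tape : finType;
  work_symbol : finType;
  blank : work_symbol;
  tdelta : tstate -> input_symbol Sigma -> {ffun work_tape -> work_symbol} ->
    tstate * direction * {ffun work_tape -> work_symbol * direction}
      * option Gamma
}.
Arguments tdelta {Sigma Gamma} t.

(* [cells] is the visited part of a work tape; all cells beyond are blank. *)
Record tape (A : Type) := Tape { cells : seq A; head_at : nat }.

Record config (Sigma Gamma : finType) (M : transducer Sigma Gamma) := Config {
  cstate : tstate M;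
  cinput : nat;
  cwork : work_tape M -> tape (work_symbol M);
  coutput : seq Gamma
}.

Definition read_input (Sigma : Type) (w : seq Sigma) (i : nat) :
    input_symbol Sigma :=
  if i is j.+1 then
    if onth w j is Some a then InputLetter a else RightEnd
  else LeftEnd.

Definition move (dir : direction) (i : nat) : nat :=
  match dir with GoLeft => i.-1 | Stay => i | GoRight => i.+1 end.

Definition update_tape (A : Type) (b : A) (tp : tape A) (act : A * direction) :
    tape A :=
  Tape (set_nth b (cells tp) (head_at tp) act.1) (move act.2 (head_at tp)).

Definition init_config (Sigma Gamma : finType) (M : transducer Sigma Gamma) :
    config M :=
  Config (tstart M) 0 (fun=> Tape [::] 0) [::].

(* Accepting and rejecting configurations are halting, hence fixed. *)
Definition step (Sigma Gamma : finType) (M : transducer Sigma Gamma)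
    (w : seq Sigma) (c : config M) : config M :=
  if (cstate c == taccept M) || (cstate c == treject M) then c else
  let: (q, dir, acts, out) :=
    tdelta M (cstate c) (read_input w (cinput c))
      [ffun t => nth (blank M) (cells (cwork c t)) (head_at (cwork c t))] in
  Config q (minn (move dir (cinput c)) (size w).+1)
    (fun t => update_tape (blank M) (cwork c t) (acts t))
    (if out is Some g then rcons (coutput c) g else coutput c).

Definition config_after (Sigma Gamma : finType) (M : transducer Sigma Gamma)
    (w : seq Sigma) (n : nat) : config M :=
  iter n (step w) (init_config M).

(* Number of work tape cells visited so far. *)
Definition space (Sigma Gamma : finType) (M : transducer Sigma Gamma)
    (c : config M) : nat :=
  \sum_(t : work_tape M) maxn (size (cells (cwork c t))) (head_at (cwork c t)).+1.

(* On undefined inputs, whatever was written before rejecting is ignored. *)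
Definition computes (Sigma Gamma : finType) (M : transducer Sigma Gamma)
    (T : seq Sigma -> option (seq Gamma)) : Prop :=
  forall w : seq Sigma, exists n : nat,
    let c := config_after M w n in
    if T w is Some v then cstate c = taccept M /\ coutput c = v
    else cstate c = treject M.

(* The work alphabet being finite, cells and bits differ by a constant factor. *)
Definition runs_in_logspace (Sigma Gamma : finType)
    (M : transducer Sigma Gamma) : Prop :=
  exists K : nat, forall (w : seq Sigma) (n : nat),
    (space (config_after M w n) <= K * maxn 1 (trunc_log 2 (size w)))%N.

Definition logspace_computable (Sigma Gamma : finType)
    (T : seq Sigma -> option (seq Gamma)) : Prop :=
  exists M : transducer Sigma Gamma, computes M T /\ runs_in_logspace M.

(* Main.v *)
Require Import Defs.
From mathcomp Require Import all_boot all_order ssralg ssrnum ssrint matrix.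
From mathcomp Require Import zify.
Set Implicit Arguments.
Unset Strict Implicit.
Unset Printing Implicit Defensive.
Import Order.TTheory GRing.Theory Num.Theory.

(** Inclusion.  An atom is a tuple of positions, that is, a bounded number of
    logarithmic counters, so that atoms can be stored but not listed in memory.
    Two things about stored atoms can be decided in logarithmic space.  Whether
    they satisfy a formula is decided by a finite automaton reading the word
    with the positions marked on it ([recognizable_sat], [log_decidable_mso]).
    Whether one atom precedes another also needs the signs of the coordinates of
    the difference of their ranks; a rank being a sum over a prefix of weights
    given by an automaton, one pass over the word accumulates it in two counters
    of linear size ([summable_rank], [log_decidable_wrp_lt]).  The output is then
    produced without sorting: in round [j], all atoms are scanned, the selected
    predecessors of each selected one are counted by a nested scan, and the label
    is written if their number is [j] ([flatten_by_rank], [runs_main]).  There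
    are polynomially many atoms, so that the counters have logarithmic size.

    Programs for this are assembled from fragments of transducers with one work
    tape ([routine]).  The tracks of the tape are binary counters, and everything
    done to counters is a finite-state pass over the tracks ([runs_pass]).  The
    space bound is part of the meaning of an execution ([reach]), so that it
    composes with the control structures.

    Strictness.  By the same automata the domain of a map given by a presentation
    is a regular language, while a transducer can count two letters and compare.
    The map that is empty on the words with as many [true] as [false] and
    undefined elsewhere is therefore not given by a presentation
    ([balanced_map_not_wrp]). *)

(** * Formulas are finite automata *)

(** Nondeterministic guessing of one bit per index, made deterministic by the
    subset construction; distinct indices make the guesses independent. *)
Lemma subset_construction (I Q : finType) (d : Q -> I -> bool -> Q)
    (s : seq I) (S : {set Q}) (q : Q) : uniq s ->
  (q \in foldl (fun S i => [set d p.1 i p.2 | p in setX S setT]) S s)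
  = [exists A : {set I}, [exists p in S,
       foldl (fun q i => d q i (i \in A)) p s == q]].
Proof.
elim: s S => [|i s IHs] S /= => [_|/andP[i_s uniq_s]].
  apply/idP/existsP => [qS|[A /exists_inP[p pS /eqP<-]]//].
  by exists set0; apply/exists_inP; exists q.
rewrite IHs //; apply/existsP/existsP => -[A /exists_inP[p]].
  case/imsetP=> -[p' b] /=; rewrite inE /= => /andP[p'S _] -> /eqP run.
  pose A' := if b then i |: A else A :\ i.
  exists A'; apply/exists_inP; exists p' => //; rewrite -run.
  have ->: (i \in A') = b by rewrite /A'; case: (b); rewrite !inE eqxx.
  apply/eqP/esym; have: forall j, j \in s -> (j \in A') = (j \in A).
    move=> j j_s; have /negPf ji: j != i by apply: contraNneq i_s => <-.
    by rewrite /A'; case: (b); rewrite !inE ji.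
  elim: (s) (d p' i b) => //= j s' IH q0 eqA.
  by rewrite eqA ?mem_head // IH // => k k_s; rewrite eqA ?inE ?k_s ?orbT.
move=> pS /eqP run; exists A; apply/exists_inP.
exists (d p i (i \in A)); last by rewrite run.
by apply/imsetP; exists (p, i \in A); rewrite // !inE pS.
Qed.

Definition annotated_run (Sigma : eqType) (w : seq Sigma) (k m : nat) (Q : Type)
    (d : Q -> Sigma -> {ffun 'I_k -> bool} -> {ffun 'I_m -> bool} -> Q) (q : Q)
    (x : 'I_k -> pos w) (X : 'I_m -> {set pos w}) (s : seq (pos w)) : Q :=
  foldl (fun q i => d q (letter i) [ffun r => x r == i] [ffun r => i \in X r])
    q s.

Lemma annotated_run_ext (Sigma : eqType) (w : seq Sigma) (k m : nat) (Q : Type)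
    (d : Q -> Sigma -> {ffun 'I_k -> bool} -> {ffun 'I_m -> bool} -> Q) (q : Q)
    (f : Q -> pos w -> Q) (x : 'I_k -> pos w) (X : 'I_m -> {set pos w}) s :
  (forall q i, f q i =
     d q (letter i) [ffun r => x r == i] [ffun r => i \in X r]) ->
  foldl f q s = annotated_run d q x X s.
Proof.
by move=> E; rewrite /annotated_run; elim: s q => //= i s IH q; rewrite E IH.
Qed.

Definition recognizable (Sigma : finType) (k m : nat)
    (P : forall w : seq Sigma, ('I_k -> pos w) -> ('I_m -> {set pos w}) -> bool) :=
  exists (Q : finType) (q0 : Q)
    (d : Q -> Sigma -> {ffun 'I_k -> bool} -> {ffun 'I_m -> bool} -> Q)
    (final : pred Q),
  forall w x X, P w x X = final (annotated_run d q0 x X (enum (pos w))).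

(** The automaton remembers whether the test has succeeded at the letter marked
    by [i], of which there is one.  Equality, letter predicates and membership
    are the instances. *)
Lemma recognizable_at (Sigma : finType) (k m : nat) (i : 'I_k)
    (t : Sigma -> {ffun 'I_k -> bool} -> {ffun 'I_m -> bool} -> bool) :
  @recognizable Sigma k m (fun w x X =>
    t (letter (x i)) [ffun r => x r == x i] [ffun r => x i \in X r]).
Proof.
pose d (q : bool) a (u : {ffun 'I_k -> bool}) v := q || (u i && t a u v).
exists bool, false, d, id => w x X; rewrite /= /annotated_run.
set f := (X in foldl X).
have run s b : foldl f b s = b || ((x i \in s) &&
    t (letter (x i)) [ffun r => x r == x i] [ffun r => x i \in X r]).
  elim: s b => [|j s IH] b /=; first by rewrite orbF.
  rewrite IH inE /f /d ffunE -orbA; congr (b || _).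
  case: (x i =P j) => [<-|_] //=.
  by case: (t _ _ _); rewrite ?andbT ?andbF.
by rewrite run mem_enum.
Qed.

(** Letters being read from left to right, it suffices to remember whether [x i]
    has been met when [x j] is. *)
Lemma recognizable_lt (Sigma : finType) (k m : nat) (i j : 'I_k) :
  @recognizable Sigma k m (fun w x X => x i < x j)%N.
Proof.
pose d (q : bool * bool) (a : Sigma) (u : {ffun 'I_k -> bool})
  (v : {ffun 'I_m -> bool}) := (q.1 || u i, q.2 || (u j && q.1)).
exists (bool * bool)%type, (false, false), d, snd => w x X.
rewrite /annotated_run; set f := (X in foldl X).
have run s b : sorted (fun p q : pos w => p < q)%N s ->
    (foldl f b s).2 = b.2 || ((x j \in s) && (b.1 || ((x i \in s) && (x i < x j)%N))).
  elim: s b => [|p s IH] b /=; first by rewrite orbF.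
  move=> srt; have lt_s : all (fun q : pos w => p < q)%N s.
    by rewrite (order_path_min _ srt) // => ? ? ?; apply: ltn_trans.
  rewrite IH ?(path_sorted srt) // /f /d !inE /= !ffunE -orbA; congr (_ || _).
  case: (x j =P p) => [xjp|_] /=; last first.
    case xjs: (x j \in s) => //=; rewrite -orbA; congr (_ || _).
    case: (x i =P p) => [->|//] /=.
    by rewrite (allP lt_s).
  have /negPf xjs : x j \notin s.
    by apply/negP => /(allP lt_s); rewrite xjp ltnn.
  rewrite xjs orbF; case: (b.1) => //=.
  case: (x i =P p) => [->|_] /=; first by rewrite xjp ltnn.
  case xis: (x i \in s) => //=.
  by have /ltnW := allP lt_s _ xis; rewrite xjp ltnNge => ->.
rewrite run /=; last first.
  have: sorted ltn [seq val p | p <- enum (pos w)].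
    by rewrite val_enum_ord iota_ltn_sorted.
  by rewrite sorted_map.
by rewrite !mem_enum.
Qed.

Lemma recognizable_not (Sigma : finType) (k m : nat) P :
  @recognizable Sigma k m P -> recognizable (fun w x X => ~~ P w x X).
Proof.
case=> Q [q0 [d [fin run]]]; exists Q, q0, d, (predC fin) => w x X.
by rewrite run.
Qed.

Lemma recognizable_and (Sigma : finType) (k m : nat) P P' :
  @recognizable Sigma k m P -> @recognizable Sigma k m P' ->
  recognizable (fun w x X => P w x X && P' w x X).
Proof.
move=> [Q [q0 [d [fin run]]]] [Q' [q0' [d' [fin' run']]]].
exists (Q * Q')%type, (q0, q0').
exists (fun q a u v => (d q.1 a u v, d' q.2 a u v)).
exists (fun q => fin q.1 && fin' q.2) => w x X; rewrite run run'.
suff ->: annotated_run (fun (q : Q * Q') a u v => (d q.1 a u v, d' q.2 a u v))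
    (q0, q0') x X (enum (pos w)) = (annotated_run d q0 x X (enum (pos w)),
   annotated_run d' q0' x X (enum (pos w))) by [].
rewrite /annotated_run; move: q0 q0' {run run'}.
by elim: (enum _) => //= i s IH q q'; rewrite IH.
Qed.

Definition annot_cons (k : nat) (b : bool) (u : {ffun 'I_k -> bool}) :
  {ffun 'I_k.+1 -> bool} := [ffun r => env_cons b u r].

Lemma annot_consE (T : Type) (P : T -> bool) (k : nat) (a : T) (e : 'I_k -> T) :
  [ffun r => P (env_cons a e r)] = annot_cons (P a) [ffun r => P (e r)].
Proof.
by apply/ffunP=> r; rewrite !ffunE /env_cons; case: unlift => [s|] /=; rewrite ?ffunE.
Qed.

(** The automaton guesses the quantified set bit by bit. *)
Lemma recognizable_exset (Sigma : finType) (k m : nat) P :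
  @recognizable Sigma k m.+1 P ->
  recognizable (fun w x X => [exists A : {set pos w}, P w x (env_cons A X)]).
Proof.
case=> Q [q0 [d [fin run]]].
exists {set Q}, [set q0].
exists (fun S a u v => [set d p.1 a u (annot_cons p.2 v) | p in setX S setT]).
exists (fun S : {set Q} => [exists q in S, fin q]) => w x X.
pose d' q i b := d q (letter i) [ffun r => x r == i]
  (annot_cons b [ffun r => i \in X r]).
have runE A : annotated_run d q0 x (env_cons A X) (enum (pos w)) =
    foldl (fun q i => d' q i (i \in A)) q0 (enum (pos w)).
  apply/esym/annotated_run_ext => q i; congr (d _ _ _ _).
  exact/esym/(annot_consE (fun B : {set pos w} => i \in B)).
rewrite -(@annotated_run_ext _ w _ _ _ _ _
  (fun S i => [set d' p.1 i p.2 | p in setX S setT])) //.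
apply/existsP/exists_inP => [[A]|[q]].
  rewrite run runE => fin_q; eexists; last exact: fin_q.
  rewrite subset_construction ?enum_uniq //; apply/existsP; exists A.
  by apply/exists_inP; exists q0; rewrite ?inE.
rewrite subset_construction ?enum_uniq // => /existsP[A].
case/exists_inP=> p; rewrite inE => /eqP-> /eqP<- fin_q.
by exists A; rewrite run runE.
Qed.

(** A position is guessed as a singleton set, a second component of the state
    checking that it has exactly one element. *)
Lemma recognizable_expos (Sigma : finType) (k m : nat) P :
  @recognizable Sigma k.+1 m P ->
  recognizable (fun w x X => [exists p : pos w, P w (env_cons p x) X]).
Proof.
case=> Q [q0 [d [fin run]]].
pose single (w : seq Sigma) (x : 'I_k -> pos w) (X : 'I_m.+1 -> {set pos w}) :=
  [exists p : pos w, (X ord0 == [set p]) &&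
     P w (env_cons p x) (fun r => X (lift ord0 r))].
suff: recognizable single.
  case/recognizable_exset=> Q' [q0' [d' [fin' run']]].
  exists Q', q0', d', fin' => w x X; rewrite -run'.
  apply/existsP/existsP => [[p Pp]|[A /existsP[p /andP[_ Pp]]]].
    exists [set p]; apply/existsP; exists p; apply/andP; split.
      by rewrite /env_cons unlift_none.
    rewrite run in Pp; rewrite run; congr (fin _): Pp.
    apply/esym/annotated_run_ext => q i; congr (d _ _ _ _).
    by apply/ffunP=> r; rewrite !ffunE /env_cons liftK.
  exists p; rewrite run in Pp; rewrite run; congr (fin _): Pp.
  apply/esym/annotated_run_ext => q i; congr (d _ _ _ _).
  by apply/ffunP=> r; rewrite !ffunE /env_cons liftK.
pose d2 (q : Q * (bool * bool)) a (u : {ffun 'I_k -> bool})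
    (v : {ffun 'I_m.+1 -> bool}) :=
  (d q.1 a (annot_cons (v ord0) u) [ffun r => v (lift ord0 r)],
   (q.2.1 || v ord0, q.2.2 || (q.2.1 && v ord0))).
exists (Q * (bool * bool))%type, (q0, (false, false)), d2.
exists (fun q => [&& fin q.1, q.2.1 & ~~ q.2.2]) => w x X.
have run1 p : X ord0 = [set p] ->
    fin (annotated_run d2 (q0, (false, false)) x X (enum (pos w))).1 =
    P w (env_cons p x) (fun r => X (lift ord0 r)).
  move=> Xp; rewrite run; congr (fin _); rewrite /annotated_run.
  move: (false, false) q0 {run}.
  elim: (enum (pos w)) => //= i s IH b q; rewrite IH; congr foldl.
  congr (d _ _ _ _); last by apply/ffunP=> r; rewrite !ffunE.
  by rewrite ffunE Xp inE eq_sym; exact/esym/(annot_consE (pred1 i)).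
have run2 s q b : (annotated_run d2 (q, b) x X s).2 =
    (b.1 || (0 < count (mem (X ord0)) s),
     b.2 || (1 < b.1 + count (mem (X ord0)) s)).
  elim: s q b => [|i s IH] q [b1 b2] /=.
    by case: b1; rewrite !orbF ?orbT.
  rewrite {1}/annotated_run /= -/(annotated_run _ _ _ _ _) IH /= !ffunE.
  by case: b1 (i \in X ord0) => [] [] /=;
    rewrite ?add0n ?add1n ?addn0 ?orbT ?orbF.
have cnt : count (mem (X ord0)) (enum (pos w)) = #|X ord0|.
  by rewrite cardE -size_filter enumT.
rewrite run2 /= cnt; apply/existsP/and3P => [[p /andP[/eqP Xp Pp]]|].
  by rewrite (run1 p Xp) Xp cards1.
case=> fin_q gt0; rewrite add0n -leqNgt => le1.
have /cards1P[p Xp] : #|X ord0| == 1 by rewrite eqn_leq le1 gt0.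
by exists p; rewrite Xp eqxx -run1.
Qed.

(** Buchi's theorem, for formulas with free variables. *)
Theorem recognizable_sat (Sigma : finType) (k m : nat) (phi : mso Sigma k m) :
  recognizable (fun w x X => sat phi x X).
Proof.
elim: phi => {k m} [k m i j|k m i j|k m a i|k m i j|k m f IH|k m f IHf g IHg
                   |k m f IH|k m f IH] /=.
- exact: recognizable_lt.
- have [] := @recognizable_at Sigma k m i (fun _ u _ => u j).
  move=> Q [q0 [d [fin run]]]; exists Q, q0, d, fin => w x X.
  by rewrite -run ffunE eq_sym.
- exact: (@recognizable_at Sigma k m i (fun b _ _ => b == a)).
- have [] := @recognizable_at Sigma k m i (fun _ _ v => v j).
  move=> Q [q0 [d [fin run]]]; exists Q, q0, d, fin => w x X.
  by rewrite -run ffunE.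
- exact: recognizable_not IH.
- exact: recognizable_and IHf IHg.
- exact: recognizable_expos IH.
- exact: recognizable_exset IH.
Qed.

(** * Routines: fragments of transducers *)

Section Routines.
Variables (Sigma Gamma R : finType).

(** The tracks of the single work tape are the registers [R], in binary, least
    significant bit first.  Cell 0 holds the mark [Some None]. *)
Definition column : finType := {ffun R -> bool}.
Definition symbol : finType := option (option column).

(** A routine receives a value of [F] in its finite control and returns one of
    [G] at the exit [inr g]; typing the finite data lets routines be composed
    like functions. *)
Record routine (F G : Type) := Routine {
  point : finType;
  entry : F -> point;
  trans : point -> input_symbol Sigma -> symbol ->
    (point + G) * direction * (symbol * direction) * option Gamma
}.

Record memory := Memory {
  mhead : nat;
  mtape : tape symbol;
  mout : seq Gamma
}.

Section Runs.
Variables (w : seq Sigma) (width : nat).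

Definition mstep F G (P : routine F G) (s : point P) (m : memory) :
    (point P + G) * memory :=
  let: (c, dir, act, out) := trans s (read_input w (mhead m))
    (nth None (cells (mtape m)) (head_at (mtape m))) in
  (c, Memory (minn (move dir (mhead m)) (size w).+1)
        (update_tape None (mtape m) act)
        (if out is Some g then rcons (mout m) g else mout m)).

(** Besides the columns there are the mark and the first blank. *)
Definition fits (m : memory) : bool :=
  maxn (size (cells (mtape m))) (head_at (mtape m)).+1 <= width.+2.

(** The space is bounded all along, not only at the end points. *)
Inductive reach F G (P : routine F G) :
    point P + G -> memory -> point P + G -> memory -> Prop :=
| reach_refl c m : fits m -> reach c m c m
| reach_step s m c' m' : fits m ->
    reach (mstep s m).1 (mstep s m).2 c' m' -> reach (inl s) m c' m'.

Lemma reach_trans F G (P : routine F G) c1 m1 c2 m2 c3 m3 :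
  @reach F G P c1 m1 c2 m2 -> reach c2 m2 c3 m3 -> reach c1 m1 c3 m3.
Proof. by elim=> // s m c m' fm _ IH /IH; apply: reach_step. Qed.

(** A control structure contains the points of its parts and only redirects their
    exits, so that an execution of a part is one of the whole. *)
Lemma reach_embed F G F' G' (P : routine F G) (P' : routine F' G')
    (embed : point P + G -> point P' + G') (sub : point P -> point P') :
  (forall s, embed (inl s) = inl (sub s)) ->
  (forall s a b, trans (sub s) a b =
    let: (c, dir, act, out) := trans s a b in (embed c, dir, act, out)) ->
  forall c m c' m', reach c m c' m' -> reach (embed c) m (embed c') m'.
Proof.
move=> embedE transE c m c' m'; elim=> [{}c {}m fm|s {}m {}c' {}m' fm _ IH].
  exact: reach_refl.
rewrite embedE; apply: reach_step => //; move: IH.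
by rewrite /mstep transE; case: (trans _ _ _) => [[[]]].
Qed.

(** ** Memories representing registers *)

Fixpoint value (cols : seq column) (r : R) : nat :=
  if cols is c :: cols' then c r + (value cols' r).*2 else 0.

(** Visited blank cells are identified with unvisited ones. *)
Definition holds (tp : tape symbol) (cols : seq column) : Prop :=
  (forall i, nth None (cells tp) i =
     nth None (Some None :: [seq Some (Some c) | c <- cols]) i)
  /\ size (cells tp) <= (size cols).+2.

Definition store : Type := {ffun R -> nat}.

Definition represents (s : store) (i : nat) (o : seq Gamma) (m : memory) :=
  exists2 cols, holds (mtape m) cols &
    [/\ head_at (mtape m) = 0, mhead m = i, mout m = o, size cols <= width
      & forall r, value cols r = s r].

(** The work tape head is at the left end before and after each routine. *)
Definition runs F G (P : routine F G) (f : F) (s : store) (i : nat)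
    (o : seq Gamma) (g : G) (s' : store) (i' : nat) (o' : seq Gamma) : Prop :=
  forall m, represents s i o m ->
    exists2 m', represents s' i' o' m' & reach (inl (entry P f)) m (inr g) m'.

(** ** Control structures *)

Definition seqr F G H (P : routine F G) (Q : routine G H) : routine F H :=
  @Routine F H (point P + point Q)%type (fun f => inl (entry P f))
   (fun s a b => match s with
    | inl s => let: (c, dir, act, out) := trans s a b in
        (inl (match c with inl s => inl s | inr g => inr (entry Q g) end),
         dir, act, out)
    | inr s => let: (c, dir, act, out) := trans s a b in
        (match c with inl s => inl (inr s) | inr h => inr h end, dir, act, out)
    end).

Lemma runs_seq F G H (P : routine F G) (Q : routine G H)
    f s i o g s' i' o' h s'' i'' o'' :
  runs P f s i o g s' i' o' -> runs Q g s' i' o' h s'' i'' o'' ->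
  runs (seqr P Q) f s i o h s'' i'' o''.
Proof.
move=> runP runQ m /runP[m' /runQ[m'' rep reachQ] reachP]; exists m'' => //.
apply: (@reach_trans _ _ (seqr P Q) _ _ (inl (inr (entry Q g))) m').
  pose embed c := inl (match c with inl s => inl s
    | inr g => inr (entry Q g) end) : point (seqr P Q) + H.
  exact: (@reach_embed _ _ _ _ P (seqr P Q) embed inl _ _ _ _ _ _ reachP).
pose embed c : point (seqr P Q) + H :=
  match c with inl s => inl (inr s) | inr h => inr h end.
exact: (@reach_embed _ _ _ _ Q (seqr P Q) embed inr _ _ _ _ _ _ reachQ).
Qed.

Definition caser F F' G (P : routine F G) (Q : routine F' G) :
    routine (F + F') G :=
  @Routine _ G (point P + point Q)%type
   (fun f => match f with inl f => inl (entry P f) | inr f => inr (entry Q f) end)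
   (fun s a b => match s with
    | inl s => let: (c, dir, act, out) := trans s a b in
        (match c with inl s => inl (inl s) | inr g => inr g end, dir, act, out)
    | inr s => let: (c, dir, act, out) := trans s a b in
        (match c with inl s => inl (inr s) | inr h => inr h end, dir, act, out)
    end).

Lemma runs_casel F F' G (P : routine F G) (Q : routine F' G)
    f s i o g s' i' o' :
  runs P f s i o g s' i' o' -> runs (caser P Q) (inl f) s i o g s' i' o'.
Proof.
move=> runP m /runP[m' rep reachP]; exists m' => //.
pose embed c : point (caser P Q) + G :=
  match c with inl s => inl (inl s) | inr h => inr h end.
exact: (@reach_embed _ _ _ _ P (caser P Q) embed inl _ _ _ _ _ _ reachP).
Qed.

Lemma runs_caser F F' G (P : routine F G) (Q : routine F' G)
    f s i o g s' i' o' :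
  runs Q f s i o g s' i' o' -> runs (caser P Q) (inr f) s i o g s' i' o'.
Proof.
move=> runQ m /runQ[m' rep reachQ]; exists m' => //.
pose embed c : point (caser P Q) + G :=
  match c with inl s => inl (inr s) | inr h => inr h end.
exact: (@reach_embed _ _ _ _ Q (caser P Q) embed inr _ _ _ _ _ _ reachQ).
Qed.

(** The loop has no test of its own: the body goes on by returning on the left
    and stops by returning on the right. *)
Definition iterr F G (P : routine F (F + G)) : routine F G :=
  @Routine F G (point P) (entry P)
   (fun s a b => let: (c, dir, act, out) := trans s a b in
      (match c with
       | inl s => inl s | inr (inl f) => inl (entry P f) | inr (inr g) => inr g
       end, dir, act, out)).

Lemma reach_iter F G (P : routine F (F + G)) s m c m' :
  reach (P := P) (inl s) m c m' ->
  reach (P := iterr P) (inl s) m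
    (match c with
     | inl s => inl s | inr (inl f) => inl (entry P f) | inr (inr g) => inr g
     end) m'.
Proof.
pose embed c : point (iterr P) + G := match c with
  | inl s => inl s | inr (inl f) => inl (entry P f) | inr (inr g) => inr g end.
exact: (@reach_embed _ _ _ _ P (iterr P) embed id _ _ (inl s)).
Qed.

Lemma runs_iter_end F G (P : routine F (F + G)) f s i o g s' i' o' :
  runs P f s i o (inr g) s' i' o' -> runs (iterr P) f s i o g s' i' o'.
Proof. by move=> runP m /runP[m' rep /reach_iter reachP]; exists m'. Qed.

Lemma runs_iter_next F G (P : routine F (F + G))
    f s i o f' s' i' o' g s'' i'' o'' :
  runs P f s i o (inl f') s' i' o' ->
  runs (iterr P) f' s' i' o' g s'' i'' o'' ->
  runs (iterr P) f s i o g s'' i'' o''.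
Proof.
move=> runP runI m /runP[m' /runI[m'' rep reachI] /reach_iter reachP].
by exists m'' => //; apply: reach_trans reachP reachI.
Qed.

Definition premap F F' G (h : F' -> F) (P : routine F G) : routine F' G :=
  Routine (fun f => entry P (h f)) (@trans _ _ P).

Lemma runs_premap F F' G (h : F' -> F) (P : routine F G) f s i o g s' i' o' :
  runs P (h f) s i o g s' i' o' -> runs (premap h P) f s i o g s' i' o'.
Proof.
move=> runP m /runP[m' rep reachP]; exists m' => //.
apply: (@reach_embed _ _ _ _ P (premap h P) id id _ _ _ _ _ _ reachP) => //.
by move=> q a b /=; case: trans => [[[]]].
Qed.

(** ** Primitive routines *)

Definition act (F : finType) (G : Type)
    (h : F -> input_symbol Sigma -> G * direction * option Gamma) :
    routine F G :=
  @Routine F G F id (fun f a b =>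
    let: (g, dir, out) := h f a in (inr g, dir, (b, Stay), out)).


Lemma runs_act (F : finType) G
    (h : F -> input_symbol Sigma -> G * direction * option Gamma)
    (f : F) s i o g dir out :
  h f (read_input w i) = (g, dir, out) ->
  runs (act h) f s i o g s (minn (move dir i) (size w).+1)
    (if out is Some a then rcons o a else o).
Proof.
move=> hE [i1 tp o1] [cols [] /= nthE le_size [hd -> -> le_w valE]].
pose tp' := update_tape None tp (nth None (cells tp) (head_at tp), Stay).
exists (Memory (minn (move dir i) (size w).+1) tp'
  (if out is Some a then rcons o a else o)).
  exists cols; last by split.
  split=> [j|]; rewrite /tp' /= hd.
    by rewrite nth_set_nth /=; case: eqP => [->|_]; rewrite nthE.
  by rewrite size_set_nth geq_max le_size.
have fits0 : fits (Memory i tp o).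
  by rewrite /fits /= hd geq_max; apply/andP; split; lia.
apply: reach_step => //=; rewrite /mstep /= hE /= -/tp'.
apply: reach_refl; rewrite /fits /= hd size_set_nth; lia.
Qed.

(** Reading all registers at once, from the least significant bits on, makes every
    operation on them a finite-state transduction; a carry may end in a new
    column. *)
Definition pass (F S G : finType) (init : F -> S)
    (tr : S -> column -> S * column) (fin : S -> G * option column) :
    routine F G :=
  @Routine F G (S + G)%type (fun f => inl (init f))
   (fun p _ b => match p, b with
    | inl s, Some None => (inl (inl s), Stay, (b, GoRight), None)
    | inl s, Some (Some c) =>
        (inl (inl (tr s c).1), Stay, (Some (Some (tr s c).2), GoRight), None)
    | inl s, None =>
        (inl (inr (fin s).1), Stay, (omap Some (fin s).2, GoLeft), None)
    | inr g, Some None => (inr g, Stay, (b, Stay), None)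
    | inr g, _ => (inl (inr g), Stay, (b, GoLeft), None)
    end).

Fixpoint transduce (S : Type) (tr : S -> column -> S * column) (s : S)
    (cols : seq column) : S * seq column :=
  if cols is c :: cols' then
    let: (s', rest) := transduce tr (tr s c).1 cols' in (s', (tr s c).2 :: rest)
  else (s, [::]).

Lemma size_transduce (S : Type) (tr : S -> column -> S * column) s cols :
  size (transduce tr s cols).2 = size cols.
Proof.
elim: cols s => //= c cols IH s.
by have := IH (tr s c).1; case: (transduce _ _ _) => s' r /= ->.
Qed.

Lemma holds_cell (tp : tape symbol) (cols : seq column) j :
  holds tp cols -> nth None (cells tp) j.+1 =
    if j < size cols then Some (Some (nth [ffun=> false] cols j)) else None.
Proof.
case=> -> _ /=; case: ltnP => [lt_j|le_j]; first exact: nth_map.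
by rewrite nth_default ?size_map.
Qed.

Lemma holds_fits i o (tp : tape symbol) (cols : seq column) :
  holds tp cols -> size cols <= width -> head_at tp <= (size cols).+1 ->
  fits (Memory i tp o).
Proof.
case=> _ le_size le_w le_hd; rewrite /fits geq_max /=; apply/andP; split.
  exact: leq_trans le_size _.
by rewrite ltnS (leq_trans le_hd).
Qed.

Lemma holds_mark (tp : tape symbol) (cols : seq column) :
  holds tp cols -> nth None (cells tp) 0 = Some None.
Proof. by case=> ->. Qed.

(** A step that only moves still writes, which may make the first blank a visited
    cell. *)
Lemma holds_keep (tp : tape symbol) (cols : seq column) dir :
  holds tp cols -> head_at tp <= (size cols).+1 ->
  holds (update_tape None tp (nth None (cells tp) (head_at tp), dir)) cols.
Proof.
case=> nthE le_size le_head; split=> [j|] /=; last first.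
  by rewrite size_set_nth geq_max le_size ltnS le_head.
by rewrite nth_set_nth /= -nthE; case: eqP => // ->.
Qed.

Lemma holds_replace (tp : tape symbol) pre c c' post dir :
  holds tp (pre ++ c :: post) -> head_at tp = (size pre).+1 ->
  holds (update_tape None tp (Some (Some c'), dir)) (pre ++ c' :: post).
Proof.
case=> nthE le_size hd; split=> [j|] /=; last first.
  by move: le_size; rewrite size_set_nth hd !size_cat /=; lia.
rewrite nth_set_nth /= hd nthE; case: j => //= j; rewrite eqSS !map_cat !nth_cat /=.
rewrite !size_map; case: ltnP => [lt_j|le_j]; first by rewrite ltn_eqF.
case: eqP => [->|ne]; first by rewrite subnn.
case E: (j - size pre) => [|d] //; case: ne; apply/eqP.
by rewrite eqn_leq le_j -subn_eq0 E.
Qed.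

Lemma holds_append (tp : tape symbol) cols c dir :
  holds tp cols -> head_at tp = (size cols).+1 ->
  holds (update_tape None tp (Some (Some c), dir)) (rcons cols c).
Proof.
case=> nthE le_size hd; split=> [j|] /=; last first.
  by rewrite size_set_nth hd size_rcons geq_max leqnSn (leq_trans le_size).
rewrite nth_set_nth /= hd nthE; case: j => //= j.
rewrite eqSS map_rcons nth_rcons size_map.
by case: ltngtP => // lt_j; rewrite nth_default ?size_map // ltnW.
Qed.

(** [pre] is the part that has already been rewritten. *)
Lemma pass_forward (F S G : finType) (init : F -> S) tr
    (fin : S -> G * option column) i o s pre cols tp :
  holds tp (pre ++ cols) -> size (pre ++ cols) <= width ->
  head_at tp = (size pre).+1 -> i <= (size w).+1 ->
  exists2 tp', holds tp' (pre ++ (transduce tr s cols).2) /\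
      head_at tp' = (size (pre ++ cols)).+1 &
    reach (P := pass init tr fin) (inl (inl s)) (Memory i tp o)
      (inl (inl (transduce tr s cols).1)) (Memory i tp' o).
Proof.
elim: cols s pre tp => [|c cols IH] s pre tp hold le_w hd le_i /=.
  rewrite cats0 in hold le_w *; exists tp => //.
  by apply: reach_refl; apply: (holds_fits _ _ hold); rewrite ?hd.
have cellE : nth None (cells tp) (head_at tp) = Some (Some c).
  rewrite hd (holds_cell _ hold) size_cat /= nth_cat ltnn subnn /=.
  by rewrite addnS ltnS leq_addr.
have [|||//|] := IH (tr s c).1 (rcons pre (tr s c).2)
    (update_tape None tp (Some (Some (tr s c).2), GoRight)).
- by rewrite cat_rcons; apply: holds_replace hold hd.
- by move: le_w; rewrite cat_rcons !size_cat.
- by rewrite /= hd size_rcons.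
case: (transduce _ _ _) => s' r tp' [hold' hd'] reach'.
exists tp'.
  by split; [rewrite /= -cat_rcons | rewrite hd' cat_rcons !size_cat].
apply: reach_step.
  by apply: (holds_fits _ _ hold); rewrite // hd size_cat /= addnS; lia.
by rewrite /mstep /= cellE /= (minn_idPl le_i).
Qed.

Lemma pass_back (F S G : finType) (init : F -> S) tr
    (fin : S -> G * option column) i o g cols tp :
  holds tp cols -> size cols <= width ->
  head_at tp <= size cols -> i <= (size w).+1 ->
  exists2 tp', holds tp' cols /\ head_at tp' = 0 &
    reach (P := pass init tr fin) (inl (inr g)) (Memory i tp o)
      (inr g) (Memory i tp' o).
Proof.
move=> hold le_w le_hd le_i; move: {2}(head_at tp) (erefl (head_at tp)) => h.
elim: h tp hold le_hd => [|h IH] tp hold le_hd hd.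
  pose tp' := update_tape None tp (nth None (cells tp) (head_at tp), Stay).
  have hold' : holds tp' cols by apply: holds_keep; rewrite ?hd.
  exists tp' => //.
  have mark : nth None (cells tp) (head_at tp) = Some None.
    by rewrite hd (holds_mark hold).
  apply: reach_step; first by apply: (holds_fits _ _ hold); rewrite ?hd.
  rewrite /mstep /= mark /= -mark -/tp' (minn_idPl le_i); apply: reach_refl.
  by apply: (holds_fits _ _ hold'); rewrite //= hd.
pose tp' := update_tape None tp (nth None (cells tp) (head_at tp), GoLeft).
have [||/=|tp2 h2 r2] := IH tp'.
- by apply: holds_keep => //; apply: leqW.
- by rewrite /= hd ltnW // -hd.
- by rewrite hd.
exists tp2 => //; apply: reach_step.
  by apply: (holds_fits _ _ hold); rewrite // ltnW.
have [c cellE] : exists c, nth None (cells tp) (head_at tp) = Some (Some c).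
  by rewrite hd (holds_cell _ hold) -hd le_hd; eexists.
by rewrite /mstep /= cellE /= -cellE (minn_idPl le_i).
Qed.

(** The tape grows at the turning point only, whence the condition on the size of
    [cols2]. *)
Lemma runs_pass (F S G : finType) (init : F -> S) tr
    (fin : S -> G * option column) (f : F) (st st' : store) i o g :
  i <= (size w).+1 ->
  (forall cols, size cols <= width -> (forall r, value cols r = st r) ->
    let: (s, cols') := transduce tr (init f) cols in
    let cols2 := if (fin s).2 is Some c then rcons cols' c else cols' in
    [/\ (fin s).1 = g, size cols2 <= width & forall r, value cols2 r = st' r]) ->
  runs (pass init tr fin) f st i o g st' i o.
Proof.
move=> le_i tr_ok [i1 tp o1] [cols /= hold [hd -> -> le_w valE]].
have := tr_ok cols le_w valE; have := size_transduce tr (init f) cols.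
have [|//|//||] := @pass_forward F S G init tr fin i o (init f) [::] cols
   (update_tape None tp (nth None (cells tp) (head_at tp), GoRight)).
- by rewrite cat0s; apply: holds_keep => //; rewrite hd.
- by rewrite /= hd.
- by [].
case: (transduce _ _ _) => s cols' /= tp1 [hold1 hd1] reach1 sizeE [gE le_w2 val2].
have holdL : holds (update_tape None tp1 (omap Some (fin s).2, GoLeft))
    (if (fin s).2 is Some c then rcons cols' c else cols').
  case: (fin s).2 => [c|] /=; first by apply: holds_append => //; rewrite sizeE.
  have none : nth None (cells tp1) (head_at tp1) = None.
    by rewrite hd1 (holds_cell _ hold1) sizeE ltnn.
  by rewrite -[X in (X, GoLeft)]none; apply: holds_keep; rewrite // hd1 sizeE.
have [||tp2 [hold2 hd2] reach2] := @pass_back F S G init tr fin i o g _ _ holdL le_w2.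
- rewrite /= hd1 /= -sizeE; case: (fin s).2 => [c|] //.
  by rewrite size_rcons.
- by [].
exists (Memory i tp2 o); first by eexists; [exact: hold2|split].
apply: reach_step; first by apply: (holds_fits _ _ hold); rewrite ?hd.
have mark : nth None (cells tp) (head_at tp) = Some None.
  by rewrite hd (holds_mark hold).
rewrite /mstep /= mark /= (minn_idPl le_i) -mark; apply: reach_trans reach1 _.
apply: reach_step.
  by apply: (holds_fits _ _ hold1); rewrite ?hd1 ?sizeE.
rewrite /mstep /= hd1 (holds_cell _ hold1) sizeE ltnn /= (minn_idPl le_i) gE.
exact: reach2.
Qed.

End Runs.
End Routines.

Arguments act {Sigma Gamma R F G} h.

(** * Register operations *)

Section Registers.
Variables (Sigma Gamma R : finType) (w : seq Sigma) (width : nat).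
Local Notation routine := (routine Sigma Gamma R).
Local Notation runs := (runs w width).
Implicit Types (s : store R) (i : nat) (o : seq Gamma).

Definition ret (F : finType) (G : Type) (h : F -> G) : routine F G :=
  act (fun f _ => (h f, Stay, None)).

Lemma runs_ret (F : finType) G (h : F -> G) f s i o :
  i <= (size w).+1 -> runs (ret h) f s i o (h f) s i o.
Proof.
move=> le_i; rewrite -{2}(minn_idPl le_i).
exact: (@runs_act Sigma Gamma R w width F G _ f s i o (h f) Stay None).
Qed.

Lemma value_rcons (cols : seq (column R)) c r :
  value (rcons cols c) r = value cols r + c r * 2 ^ size cols.
Proof.
elim: cols => [|c' cols IH] /=; first by rewrite expn0 muln1 addn0.
by rewrite IH doubleD addnA expnS -!mul2n mulnCA.
Qed.

Definition upd s r v : store R := [ffun r' => if r' == r then v else s r'].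

Definition incr (F : finType) (reg : F -> R) : routine F F :=
  @pass Sigma Gamma R F (F * bool)%type F (fun f => (f, true))
    (fun fc col => ((fc.1, fc.2 && col (reg fc.1)),
       [ffun r => if r == reg fc.1 then col r (+) fc.2 else col r]))
    (fun fc => (fc.1, if fc.2 then Some [ffun r => r == reg fc.1] else None)).

(** A column is added when the new value is [2 ^ size cols]; the number of columns
    is therefore at most [width] as long as the values are below [2 ^ width]. *)
Lemma runs_incr (F : finType) (reg : F -> R) f s i o :
  i <= (size w).+1 -> (s (reg f)).+1 < 2 ^ width ->
  runs (incr reg) f s i o f (upd s (reg f) (s (reg f)).+1) i o.
Proof.
move=> le_i lt_s; apply: runs_pass => // cols le_w valE /=.
set tr := (X in transduce X).
have carry b : let: (fc, cols') := transduce tr (f, b) cols in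
    [/\ fc.1 = f, size cols' = size cols,
        (forall r, r != reg f -> value cols' r = value cols r)
      & value cols' (reg f) + fc.2 * 2 ^ size cols = value cols (reg f) + b].
  elim: cols b {le_w valE} => [|c cols IH] b /=.
    by split=> //; rewrite expn0 muln1.
  have {IH} := IH (b && c (reg f)).
  case: (transduce _ _ _) => [[f' b'] cols'] /= [-> sz other this].
  split=> // [|r /[dup] /negPf ne_r /other <-|]; first by rewrite /= sz.
    by rewrite ffunE ne_r.
  rewrite ffunE eqxx expnS -mul2n mulnCA -addnA -mulnDr this.
  by case: (b) (c (reg f)) => [] [] /=; lia.
have := carry true; case: (transduce _ _ _) => [[f' b'] cols'] /= [-> sz other this].
split=> //; case: b' this => //= this.
- rewrite size_rcons sz -(@ltn_exp2l 2) //; apply: leq_ltn_trans lt_s.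
  by rewrite -valE -[(value _ _).+1]addn1 -this mul1n leq_addl.
- by rewrite sz.
- move=> r; rewrite ffunE value_rcons sz ffunE; case: eqP => [->|/eqP ne].
    by rewrite -valE this addn1.
  by rewrite other // valE mul0n addn0.
- move=> r; rewrite ffunE; case: eqP => [->|/eqP ne]; last by rewrite other.
  by rewrite -valE -[LHS]addn0 this addn1.
Qed.

Definition clear (F : finType) (r : R) : routine F F :=
  @pass Sigma Gamma R F F F id
    (fun f col => (f, [ffun r' => (r' != r) && col r'])) (fun f => (f, None)).

Lemma runs_clear (F : finType) r (f : F) s i o :
  i <= (size w).+1 -> runs (clear F r) f s i o f (upd s r 0) i o.
Proof.
move=> le_i; apply: runs_pass => // cols le_w valE /=.
set tr := (X in transduce X).
have: let: (f', cols') := transduce tr f cols in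
  [/\ f' = f, size cols' = size cols &
    forall r', value cols' r' = if r' == r then 0 else value cols r'].
  elim: cols {le_w valE} => [|c cols IH] /=.
    by split=> // r'; rewrite if_same.
  case: (transduce _ _ _) IH => f' cols' /= [-> -> val']; split=> // r'.
  by rewrite val' ffunE; case: eqP.
case: (transduce _ _ _) => f' cols' [-> -> val']; split=> // r'.
by rewrite val' ffunE valE.
Qed.

(** The most significant difference decides a comparison, and is read last. *)
Definition compare (F : finType) : routine F (F * {ffun R * R -> bool})%type :=
  @pass Sigma Gamma R F (F * {ffun R * R -> bool})%type _
    (fun f => (f, [ffun=> false]))
    (fun fm col => ((fm.1,
       [ffun p => if col p.1 == col p.2 then fm.2 p else col p.2]), col))
    (fun fm => (fm, None)).

Definition lts s : {ffun R * R -> bool} := [ffun p => s p.1 < s p.2].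

Lemma runs_compare (F : finType) (f : F) s i o :
  i <= (size w).+1 -> runs (compare F) f s i o (f, lts s) s i o.
Proof.
move=> le_i; apply: runs_pass => // cols le_w valE /=.
set tr := (X in transduce X).
have cmp m : transduce tr (f, m) cols = ((f, [ffun p =>
    if value cols p.1 == value cols p.2 then m p
    else value cols p.1 < value cols p.2]), cols).
  elim: cols m {le_w valE} => [|c cols IH] m /=.
    by congr (_, _, _); apply/ffunP=> p; rewrite ffunE.
  rewrite IH; congr (_, _, _); apply/ffunP=> p; rewrite !ffunE.
  case: (c p.1) (c p.2) => [] [] /=; do ?case: ifP; lia.
rewrite cmp; split=> //; congr (_, _); apply/ffunP=> p; rewrite !ffunE !valE.
by case: eqP => // ->; rewrite ltnn.
Qed.

(** ** Adding numbers read in the finite control *)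

(** The number to be added is counted down in the finite control. *)
Definition add_num (F : finType) (reg : F -> R) (num : F -> nat) : routine F F :=
  let M := (\max_f num f).+1 in
  seqr (ret (fun f => (f, inord (num f) : 'I_M)))
   (iterr (seqr
     (ret (fun fc : F * 'I_M =>
        if val fc.2 is c.+1 then inl (fc.1, inord c : 'I_M) else inr fc.1))
     (caser (seqr (incr (fun fc : F * 'I_M => reg fc.1)) (ret inl)) (ret inr)))).

Lemma runs_add_num (F : finType) (reg : F -> R) (num : F -> nat) f s i o :
  i <= (size w).+1 -> s (reg f) + num f < 2 ^ width ->
  runs (add_num reg num) f s i o f (upd s (reg f) (s (reg f) + num f)) i o.
Proof.
move=> le_i lt_s; apply: runs_seq (runs_ret _ _ le_i) _.
have: num f <= \max_f num f by apply: leq_bigmax.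
move: (num f) lt_s => c lt_s le_c.
elim: c s le_c lt_s => [|c IH] s le_c lt_s.
  apply: runs_iter_end; apply: runs_seq (runs_ret _ _ le_i) _ => /=.
  rewrite inordK //; apply: runs_caser.
  have -> : upd s (reg f) (s (reg f) + 0) = s.
    by apply/ffunP=> r; rewrite ffunE addn0; case: eqP => // ->.
  exact: runs_ret.
apply: runs_iter_next.
  apply: runs_seq (runs_ret _ _ le_i) _ => /=.
  rewrite inordK //; apply: runs_casel; apply: runs_seq (runs_ret _ _ le_i).
  by apply: runs_incr => //=; lia.
have -> : upd s (reg f) (s (reg f) + c.+1) =
    upd (upd s (reg f) (s (reg f)).+1) (reg f)
      (upd s (reg f) (s (reg f)).+1 (reg f) + c).
  by apply/ffunP=> r; rewrite !ffunE eqxx addSnnS; case: eqP.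
by apply: IH; rewrite ?ffunE ?eqxx ?addSnnS // ltnW.
Qed.

End Registers.

Arguments ret {Sigma Gamma R F G} h.
Arguments incr {Sigma Gamma R F} reg.
Arguments clear {Sigma Gamma R F} r.
Arguments compare {Sigma Gamma R} F.
Arguments add_num {Sigma Gamma R F} reg num.

(** * Weighted automata on marked words *)

Section Automata.
Variables (Sigma : Type) (k : nat) (Q : Type).
Variable d : Q -> Sigma -> {ffun 'I_k -> bool} -> Q.
Variable z : Q -> Sigma -> {ffun 'I_k -> bool} -> int.

Definition marks (x : 'I_k -> nat) (i : nat) : {ffun 'I_k -> bool} :=
  [ffun r => x r == i].

Fixpoint run_from (x : 'I_k -> nat) (q : Q) (i : nat) (u : seq Sigma) : Q :=
  if u is a :: u' then run_from x (d q a (marks x i)) i.+1 u' else q.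

(** The sum of the absolute values of the nonnegative weights ([b] = true) or
    of the negative ones. *)
Fixpoint weight (b : bool) (x : 'I_k -> nat) (q : Q) (i : nat) (u : seq Sigma) :
    nat :=
  if u is a :: u' then
    let v := z q a (marks x i) in
    ((0 <= v)%R == b) * `|v|%N + weight b x (d q a (marks x i)) i.+1 u'
  else 0.

End Automata.

Section Sweep.
Variables (Sigma Gamma R : finType) (k : nat) (Q : finType).
Variable d : Q -> Sigma -> {ffun 'I_k -> bool} -> Q.
Variable z : Q -> Sigma -> {ffun 'I_k -> bool} -> int.
Variables (q0 : Q) (rp rn p : R) (regs : 'I_k -> R).
Local Notation routine := (routine Sigma Gamma R).

(** The register [p] follows the input head, and its comparison with the registers
    [regs] gives the marks.  Weights of different signs go to different registers,
    as these hold natural numbers. *)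
Definition sweep_letter : routine (Q * Sigma)%type (Q + Q) :=
  seqr (compare (Q * Sigma)%type)
  (seqr (ret (fun fm : Q * Sigma * {ffun R * R -> bool} => (fm.1,
     [ffun r => ~~ fm.2 (regs r, p) && ~~ fm.2 (p, regs r)] : {ffun 'I_k -> bool})))
  (seqr (add_num (fun f : Q * Sigma * {ffun 'I_k -> bool} =>
              if (0 <= z f.1.1 f.1.2 f.2)%R then rp else rn)
           (fun f => `|z f.1.1 f.1.2 f.2|%N))
  (seqr (incr (fun=> p))
     (act (fun f _ => (inl (d f.1.1 f.1.2 f.2), GoRight, None)))))).

Definition sweep_step : routine Q (Q + Q) :=
  seqr
    (act (fun q a => (if a is InputLetter a then inl (q, a) else inr q,
                        Stay, None)))
    (caser sweep_letter (ret inr)).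

Definition sweep_loop : routine Q Q := iterr sweep_step.

Definition rewind : routine Q Q :=
  iterr (act (fun q a =>
    if a is LeftEnd then (inr q, Stay, None) else (inl q, GoLeft, None))).

Definition sweep : routine unit Q :=
  seqr (act (fun _ _ => (q0, GoRight, None)))
  (seqr sweep_loop (seqr (clear p) rewind)).

Variables (w : seq Sigma) (width : nat).
Local Notation runs := (runs w width).

Lemma runs_rewind q s i o : i <= (size w).+1 -> runs rewind q s i o q s 0 o.
Proof.
rewrite /rewind; elim: i => [|i IH] le_i.
  refine (runs_iter_end _); rewrite -[X in runs _ _ _ _ _ _ _ X](min0n (size w).+1).
  by apply: (runs_act (dir := Stay) (out := None)).
apply: runs_iter_next (IH (ltnW le_i)).
rewrite -[X in runs _ _ _ _ _ _ _ X](minn_idPl (ltnW le_i)).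
apply: (runs_act (dir := GoLeft) (out := None)).
by rewrite /=; case: onth.
Qed.

Hypotheses (rp_rn : rp != rn) (p_rp : p != rp) (p_rn : p != rn).
Hypotheses (regs_rp : forall r, regs r != rp) (regs_rn : forall r, regs r != rn)
           (regs_p : forall r, regs r != p).

(** The index [p] moves by the number [c] of letters read. *)
Definition add_weights (s : store R) (c n n' : nat) : store R :=
  [ffun r => s r + (r == p) * c + (r == rp) * n + (r == rn) * n'].

Lemma runs_sweep_loop (x : 'I_k -> nat) q (s : store R) i o u :
  (forall r, s (regs r) = x r) -> drop i w = u -> i <= size w -> s p = i ->
  (size w) < 2 ^ width ->
  s rp + weight d z true x q i u < 2 ^ width ->
  s rn + weight d z false x q i u < 2 ^ width ->
  runs sweep_loop q s i.+1 o (run_from d x q i u)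
    (add_weights s (size u) (weight d z true x q i u) (weight d z false x q i u))
    (size w).+1 o.
Proof.
rewrite /sweep_loop; move=> + + + + lt_w.
elim: u i s q => [|a u IH] i s q sx du le_i sp lt_p lt_n.
  have -> : i = size w.
    by apply/eqP; rewrite eqn_leq le_i -subn_eq0 -size_drop du.
  refine (runs_iter_end _); apply: runs_seq.
    apply: (runs_act (dir := Stay) (out := None) (g := inr q)).
    by rewrite /= onth_default.
  rewrite /= minnn; apply: runs_caser.
  have -> : add_weights s 0 0 0 = s.
    by apply/ffunP=> r; rewrite ffunE !muln0 !addn0.
  exact: runs_ret.
have lt_i : i < size w by rewrite -subn_gt0 -size_drop du.
have le_i1 : i.+1 <= (size w).+1 by rewrite ltnS.
set v := z q a (marks x i); set q' := d q a (marks x i).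
set s1 := upd s (if (0 <= v)%R then rp else rn)
  (s (if (0 <= v)%R then rp else rn) + `|v|%N).
set s2 := upd s1 p i.+1.
have s1E r : s1 r = s r + (r == rp) * (((0 <= v)%R == true) * `|v|%N)
    + (r == rn) * (((0 <= v)%R == false) * `|v|%N).
  rewrite ffunE; case: (0 <= v)%R; case: (r =P rp) => [->|] //=;
  rewrite ?(negPf rp_rn) ?mul1n ?mul0n ?addn0 //; case: eqP => [->|] //=; lia.
have s1p : s1 p = i.
  by rewrite s1E (negPf p_rp) (negPf p_rn) !mul0n !addn0.
have sregs r : s2 (regs r) = x r.
  by rewrite ffunE (negPf (regs_p r)) s1E (negPf (regs_rp r)) (negPf (regs_rn r)) !addn0.
have s2rp : s2 rp = s rp + ((0 <= v)%R == true) * `|v|%N.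
  by rewrite ffunE eq_sym (negPf p_rp) s1E eqxx (negPf rp_rn) mul1n mul0n addn0.
have s2rn : s2 rn = s rn + ((0 <= v)%R == false) * `|v|%N.
  by rewrite ffunE eq_sym (negPf p_rn) s1E eqxx eq_sym (negPf rp_rn) mul1n mul0n addn0.
have : runs (iterr sweep_step) q' s2 i.+2 o (run_from d x q' i.+1 u)
   (add_weights s2 (size u) (weight d z true x q' i.+1 u)
      (weight d z false x q' i.+1 u)) (size w).+1 o.
  apply: IH => //.
  - by rewrite -addn1 addnC -drop_drop du /= drop0.
  - by rewrite ffunE eqxx.
  - by rewrite s2rp -addnA.
  - by rewrite s2rn -addnA.
have -> : add_weights s2 (size u) (weight d z true x q' i.+1 u)
      (weight d z false x q' i.+1 u) =
   add_weights s (size (a :: u)) (weight d z true x q i (a :: u))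
     (weight d z false x q i (a :: u)).
  apply/ffunP=> r; rewrite [LHS]ffunE [RHS]ffunE [s2 r]ffunE s1E /= -/v -/q'.
  case: (r =P p) => [->|_].
    by rewrite sp (negPf p_rp) (negPf p_rn) !mul0n !mul1n !addn0 addSnnS.
  by rewrite !mul0n !addn0 !mulnDr; lia.
apply: runs_iter_next.
apply: runs_seq.
  apply: (runs_act (dir := Stay) (out := None) (g := inl (q, a))).
  by rewrite /= onthE -[i]addn0 -nth_drop -map_drop du.
rewrite /= (minn_idPl le_i1); apply: runs_casel; rewrite /sweep_letter.
apply: runs_seq (runs_compare _ le_i1) _.
apply: runs_seq (runs_ret _ _ le_i1) _.
rewrite /=; set m := [ffun r => _].
have -> : m = marks x i.
  apply/ffunP=> r; rewrite !ffunE /= sx sp -!leqNgt.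
  by rewrite eqn_leq andbC.
refine (runs_seq (runs_add_num le_i1 _) _) => /=.
  rewrite -/v; case: ifP lt_p lt_n => /= -> /=; rewrite -/v; lia.
rewrite -/v -/s1; apply: runs_seq.
  apply: runs_incr => //; rewrite s1p; apply: leq_ltn_trans lt_w.
  exact: lt_i.
rewrite s1p -[X in runs _ _ _ _ _ _ _ X](minn_idPl (_ : i.+2 <= (size w).+1)) //.
exact: (runs_act (dir := GoRight) (out := None)).
Qed.

Lemma runs_sweep (x : 'I_k -> nat) (s : store R) o :
  (forall r, s (regs r) = x r) -> s p = 0 -> size w < 2 ^ width ->
  s rp + weight d z true x q0 0 w < 2 ^ width ->
  s rn + weight d z false x q0 0 w < 2 ^ width ->
  runs sweep tt s 0 o (run_from d x q0 0 w)
    (add_weights s 0 (weight d z true x q0 0 w) (weight d z false x q0 0 w)) 0 o.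
Proof.
move=> sx sp lt_w lt_p lt_n; rewrite /sweep; apply: runs_seq.
  exact: (runs_act (dir := GoRight) (out := None)).
rewrite /= (minn_idPl (_ : 1 <= (size w).+1)) //.
have loop := runs_sweep_loop (q := q0) (i := 0) (o := o) sx (drop0 w) (leq0n _) sp.
apply: runs_seq (loop lt_w lt_p lt_n) _.
apply: runs_seq (runs_clear p _ (leqnn _)) _.
have -> : upd (add_weights s (size w) (weight d z true x q0 0 w)
      (weight d z false x q0 0 w)) p 0 =
    add_weights s 0 (weight d z true x q0 0 w) (weight d z false x q0 0 w).
  apply/ffunP=> r; rewrite !ffunE; case: eqP => [->|_]; last by rewrite !muln0.
  by rewrite sp (negPf p_rp) (negPf p_rn).
exact: runs_rewind.
Qed.

End Sweep.

Arguments sweep {Sigma Gamma R k Q} d z q0 rp rn p regs.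

(** * Logarithmic-space predicates of positions *)

Section Deciders.
Variables (Sigma Gamma X : finType).

(** The pointers [X] designate the positions of atoms.  Between routines [rsize]
    holds the length of the input and [rindex], the index of sweeps, is zero. *)
Definition reg : finType := (X + 'I_6)%type.
Definition rsize : reg := inr (@Ordinal 6 0 isT).
Definition rindex : reg := inr (@Ordinal 6 1 isT).
Definition rpos : reg := inr (@Ordinal 6 2 isT).
Definition rneg : reg := inr (@Ordinal 6 3 isT).
Definition rcount : reg := inr (@Ordinal 6 4 isT).
Definition rrank : reg := inr (@Ordinal 6 5 isT).
Local Notation routine := (routine Sigma Gamma reg).
Local Notation pointers := {ffun X -> nat}.

Definition layout (n : nat) (ptr : pointers) (a b c j : nat) : store reg :=
  [ffun r : reg => match r : X + 'I_6 with
                   | inl x => ptr x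
                   | inr i => nth 0 [:: n; 0; a; b; c; j] i
                   end].

Lemma add_weights_layout n ptr a b c j a' b' :
  add_weights rpos rneg rindex (layout n ptr a b c j) 0 a' b' =
  layout n ptr (a + a') (b + b') c j.
Proof.
apply/ffunP=> -[x|[[|[|[|[|[|[|//]]]]]] lt_i]]; rewrite !ffunE /=;
  by rewrite ?muln0 ?mul0n ?mul1n ?addn0.
Qed.

Lemma upd_rpos n ptr a b c j v :
  upd (layout n ptr a b c j) rpos v = layout n ptr v b c j.
Proof. by apply/ffunP=> -[x|[[|[|[|[|[|[|//]]]]]] lt_i]]; rewrite !ffunE. Qed.

Lemma upd_rneg n ptr a b c j v :
  upd (layout n ptr a b c j) rneg v = layout n ptr a v c j.
Proof. by apply/ffunP=> -[x|[[|[|[|[|[|[|//]]]]]] lt_i]]; rewrite !ffunE. Qed.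

Lemma upd_rcount n ptr a b c j v :
  upd (layout n ptr a b c j) rcount v = layout n ptr a b v j.
Proof. by apply/ffunP=> -[x|[[|[|[|[|[|[|//]]]]]] lt_i]]; rewrite !ffunE. Qed.

Lemma upd_rrank n ptr a b c j v :
  upd (layout n ptr a b c j) rrank v = layout n ptr a b c v.
Proof. by apply/ffunP=> -[x|[[|[|[|[|[|[|//]]]]]] lt_i]]; rewrite !ffunE. Qed.

Definition updp (ptr : pointers) (x : X) (v : nat) : pointers :=
  [ffun x' => if x' == x then v else ptr x'].

Lemma upd_ptr n ptr a b c j x v :
  upd (layout n ptr a b c j) (inl x) v = layout n (updp ptr x v) a b c j.
Proof. by apply/ffunP=> -[x'|i]; rewrite !ffunE //=. Qed.

Definition position_predicate (k : nat) :=
  forall w : seq Sigma, ('I_k -> pos w) -> bool.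

(** The registers and the output are left as they were, so that a decider can be
    called anywhere.  [C] makes room for the quantities, linear in the length,
    that it computes in between. *)
Definition decider (k : nat) (y : 'I_k -> X) (P : position_predicate k)
    (D : routine unit bool) (C : nat) : Prop :=
  forall w width (x : 'I_k -> pos w) (ptr : pointers) c j o,
  C * (size w).+1 < 2 ^ width -> (forall r, ptr (y r) = x r) ->
  runs w width D tt (layout (size w) ptr 0 0 c j) 0 o
       (P w x) (layout (size w) ptr 0 0 c j) 0 o.

Definition log_decidable (k : nat) (y : 'I_k -> X) (P : position_predicate k) :=
  exists DC : routine unit bool * nat, decider y P DC.1 DC.2.

Definition branch F G (P : routine unit F) (Q : routine unit F)
  (D : routine G bool) : routine G F :=
  seqr D (premap (fun b : bool => if b then inl tt else inr tt) (caser P Q)).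

Lemma runs_branch w width F G (P Q : routine unit F) (D : routine G bool)
    g s i o b s' i' o' f s'' i'' o'' :
  runs w width D g s i o b s' i' o' ->
  runs w width (if b then P else Q) tt s' i' o' f s'' i'' o'' ->
  runs w width (branch P Q D) g s i o f s'' i'' o''.
Proof.
move=> runD runPQ; refine (runs_seq runD (runs_premap _)).
by case: b runPQ {runD} => run; [refine (runs_casel _ _)|refine (runs_caser _ _)].
Qed.

Lemma log_decidable_bool2 (f : bool -> bool -> bool) k (y : 'I_k -> X)
    (P Q : position_predicate k) :
  log_decidable y P -> log_decidable y Q ->
  log_decidable y (fun w x => f (P w x) (Q w x)).
Proof.
case=> [[D C] /= DP] [[D' C'] /= DQ].
exists (branch (seqr D' (ret (f true))) (seqr D' (ret (f false))) D,
        C + C') => w width x ptr c j o /= bound yx.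
apply: runs_branch (DP w width x ptr c j o _ yx) _.
  by apply: leq_ltn_trans bound; rewrite leq_mul2r leq_addr orbT.
have DQ' := DQ w width x ptr c j o _ yx.
case: (P w x); (apply: runs_seq (runs_ret _ _ _); last by []); apply: DQ'.
all: by apply: leq_ltn_trans bound; rewrite leq_mul2r leq_addl orbT.
Qed.

Lemma log_decidable_ext k (y : 'I_k -> X) (P Q : position_predicate k) :
  (forall w x, P w x = Q w x) -> log_decidable y P -> log_decidable y Q.
Proof.
move=> PQ [[D C] /= DP]; exists (D, C) => w width x ptr c j o /= bound yx.
by rewrite -PQ; apply: DP.
Qed.

Lemma log_decidable_const k (y : 'I_k -> X) b : log_decidable y (fun w x => b).
Proof.
exists (ret (fun=> b), 0) => w width x ptr c j o /= _ _.
exact: (runs_ret (fun=> b)).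
Qed.

Lemma log_decidable_has (T : Type) k (y : 'I_k -> X)
    (P : T -> position_predicate k) (s : seq T) :
  (forall t, log_decidable y (P t)) ->
  log_decidable y (fun w x => has (fun t => P t w x) s).
Proof.
move=> dP; elim: s => [|t s IH] /=; first exact: log_decidable_const.
exact: (log_decidable_bool2 orb).
Qed.

Lemma log_decidable_not k (y : 'I_k -> X) (P : position_predicate k) :
  log_decidable y P -> log_decidable y (fun w x => ~~ P w x).
Proof. by move=> dP; apply: (log_decidable_bool2 (fun b _ => ~~ b) dP dP). Qed.

Lemma log_decidable_exists (T : finType) k (y : 'I_k -> X)
    (P : T -> position_predicate k) :
  (forall t, log_decidable y (P t)) ->
  log_decidable y (fun w x => [exists t, P t w x]).
Proof.
move/(log_decidable_has (enum T)); apply: log_decidable_ext => w x.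
apply/hasP/existsP => [[t _ Pt]|[t Pt]]; exists t => //.
by rewrite mem_enum.
Qed.

Lemma log_decidable_forall (T : finType) k (y : 'I_k -> X)
    (P : T -> position_predicate k) :
  (forall t, log_decidable y (P t)) ->
  log_decidable y (fun w x => [forall t, P t w x]).
Proof.
move=> dP; have /log_decidable_not :=
  log_decidable_exists (fun t => log_decidable_not (dP t)).
by apply: log_decidable_ext => w x; rewrite negb_exists;
  apply: eq_forallb => t; rewrite negbK.
Qed.

(** ** Formulas *)

Lemma enum_letters (w : seq Sigma) :
  [seq (letter i, val i) | i <- enum (pos w)] = zip w (iota 0 (size w)).
Proof.
case: w => [|a w]; first by apply/eqP; rewrite -size_eq0 size_map size_enum_ord.
set v := a :: w.
have sz : size (enum (pos v)) = size v by rewrite size_enum_ord.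
apply: (@eq_from_nth _ (a, 0)) => [|i]; rewrite size_map sz.
  by rewrite size_zip size_iota minnn.
move=> lt_i; rewrite (nth_map (Ordinal lt_i)) ?sz // nth_zip ?size_iota //.
rewrite nth_iota //; congr (_, _); last exact: nth_enum_ord.
by rewrite /letter (tnth_nth a) /=; congr nth; exact: nth_enum_ord.
Qed.

Lemma run_from_enum (w : seq Sigma) k Q
    (d : Q -> Sigma -> {ffun 'I_k -> bool} -> Q) (x : 'I_k -> pos w) q :
  run_from d (fun r => val (x r)) q 0 w =
  foldl (fun q i => d q (letter i) [ffun r => x r == i]) q (enum (pos w)).
Proof.
have zipE u i : run_from d (fun r => val (x r)) q i u =
    foldl (fun q p => d q p.1 (marks (fun r => val (x r)) p.2)) q
      (zip u (iota i (size u))).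
  by elim: u i q => //= a u IH i q; rewrite IH.
by rewrite zipE -enum_letters; elim: (enum _) q {zipE} => //= i s IH q; rewrite IH.
Qed.

(** A sweep without weights runs the automaton of the formula. *)
Lemma log_decidable_mso k (y : 'I_k -> X) (phi : mso Sigma k 0) :
  log_decidable y (fun w x => models phi x).
Proof.
have [Q [q0 [d [fin run]]]] := recognizable_sat phi.
pose d' q a u := d q a u [ffun=> false].
pose z (q : Q) (a : Sigma) (u : {ffun 'I_k -> bool}) : int := 0%R.
exists (seqr (sweep d' z q0 rpos rneg rindex (fun r => inl (y r)))
             (ret fin), 1) => w width x ptr c j o /=; rewrite mul1n => bound yx.
have w0 b x' q i u : weight d' z b x' q i u = 0.
  by elim: u q i => //= a u IH q i; rewrite IH muln0.
have -> : models phi x = fin (run_from d' (fun r => val (x r)) q0 0 w).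
  rewrite /models run run_from_enum; congr (fin _); apply/esym.
  apply: annotated_run_ext => q i; congr (d _ _ _ _).
  by apply/ffunP=> -[].
apply: runs_seq (runs_ret _ _ _) => //.
have := @runs_sweep Sigma Gamma reg k Q d' z q0 rpos rneg rindex
  (fun r => inl (y r)) w width isT isT isT (fun=> isT) (fun=> isT) (fun=> isT)
  (fun r => val (x r)) (layout (size w) ptr 0 0 c j) o.
rewrite !w0 add_weights_layout; apply; rewrite ?ffunE //=.
- by move=> r; rewrite ffunE yx.
- exact: ltn_trans bound.
all: by rewrite expn_gt0.
Qed.

(** ** Comparing integer sums *)

Definition position_sum (k : nat) :=
  forall w : seq Sigma, ('I_k -> pos w) -> int.

(** An integer is held as a difference of two registers, to which the routine
    adds. *)
Definition summator (k : nat) (y : 'I_k -> X) (Z : position_sum k)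
    (A : routine unit unit) (C : nat) : Prop :=
  forall w width (x : 'I_k -> pos w) (ptr : pointers),
  size w < 2 ^ width -> (forall r, ptr (y r) = x r) ->
  exists u v : nat,
    [/\ (u%:Z - v%:Z)%R = Z w x, u <= C * (size w).+1, v <= C * (size w).+1 &
    forall a b c j o, a + u < 2 ^ width -> b + v < 2 ^ width ->
      runs w width A tt (layout (size w) ptr a b c j) 0 o
         tt (layout (size w) ptr (a + u) (b + v) c j) 0 o].

Definition summable (k : nat) (y : 'I_k -> X) (Z : position_sum k) :=
  exists AC : routine unit unit * nat, summator y Z AC.1 AC.2.

Lemma summable_ext k (y : 'I_k -> X) (Z Z' : position_sum k) :
  (forall w x, Z w x = Z' w x) -> summable y Z -> summable y Z'.
Proof.
move=> ZZ' [[A C] /= AZ]; exists (A, C) => w width x ptr /= lt_w yx.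
have [u [v [uvE le_u le_v runA]]] := AZ w width x ptr lt_w yx.
by exists u, v; split; rewrite // -ZZ'.
Qed.

Lemma summable_add k (y : 'I_k -> X) (Z Z' : position_sum k) :
  summable y Z -> summable y Z' -> summable y (fun w x => Z w x + Z' w x)%R.
Proof.
move=> [[A C] /= AZ] [[A' C'] /= AZ'].
exists (seqr A A', C + C') => w width x ptr /= lt_w yx.
have [u [v [uvE le_u le_v runA]]] := AZ w width x ptr lt_w yx.
have [u' [v' [uvE' le_u' le_v' runA']]] := AZ' w width x ptr lt_w yx.
exists (u + u'), (v + v'); split.
- by rewrite -uvE -uvE'; lia.
- by rewrite mulnDl leq_add.
- by rewrite mulnDl leq_add.
move=> a b c j o lt_a lt_b; rewrite !addnA.
refine (runs_seq (runA _ _ _ _ _ _ _) (runA' _ _ _ _ _ _ _)); lia.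
Qed.

Lemma summable_const k (y : 'I_k -> X) (v : int) : summable y (fun w x => v).
Proof.
pose up := if (0 <= v)%R then rpos else rneg.
exists (add_num (fun=> up) (fun=> `|v|%N), `|v|%N) => w width x ptr /= _ _.
exists ((0 <= v)%R * `|v|%N), ((~~ (0 <= v)%R) * `|v|%N); split.
- by case: v {up} => n /=; lia.
- by case: (0 <= v)%R; rewrite ?mul1n ?mul0n // leq_pmulr.
- by case: (0 <= v)%R; rewrite ?mul1n ?mul0n // leq_pmulr.
move=> a b c j o; rewrite /up; case: (0 <= v)%R => /=;
  rewrite ?mul1n ?mul0n ?addn0 => lt_a lt_b.
- rewrite -(upd_rpos _ _ a _ _ _ (a + `|v|%N)).
  have := @runs_add_num Sigma Gamma reg w width unit
    (fun=> rpos) (fun=> `|v|%N) tt (layout (size w) ptr a b c j) 0 o isT.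
  by rewrite ffunE; apply.
- rewrite -(upd_rneg _ _ _ b _ _ (b + `|v|%N)).
  have := @runs_add_num Sigma Gamma reg w width unit
    (fun=> rneg) (fun=> `|v|%N) tt (layout (size w) ptr a b c j) 0 o isT.
  by rewrite ffunE; apply.
Qed.

Lemma summable_big (T : Type) k (y : 'I_k -> X) (Z : T -> position_sum k)
    (s : seq T) :
  (forall t, summable y (Z t)) ->
  summable y (fun w x => \sum_(t <- s) Z t w x)%R.
Proof.
move=> sZ; elim: s => [|t s IH].
  by apply: summable_ext (summable_const y 0%R) => w x; rewrite big_nil.
apply: summable_ext (summable_add (sZ t) IH) => w x; by rewrite big_cons.
Qed.

(** The weights are finitely many, hence bounded by their maximum, so that the sums
    are linear in the length. *)
Lemma summable_run k (y : 'I_k -> X) (Q : finType)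
   (d : Q -> Sigma -> {ffun 'I_k -> bool} -> Q)
   (z : Q -> Sigma -> {ffun 'I_k -> bool} -> int) (q0 : Q) :
  summable y (fun w x => (weight d z true (fun r => val (x r)) q0 0 w)%:Z -
                        (weight d z false (fun r => val (x r)) q0 0 w)%:Z)%R.
Proof.
pose C := \max_(f : Q * Sigma * {ffun 'I_k -> bool}) `|z f.1.1 f.1.2 f.2|%N.
exists (seqr (sweep d z q0 rpos rneg rindex (fun r => inl (y r)))
             (ret (fun=> tt)), C) => w width x ptr /= lt_w yx.
have le_weight b x' q i u : weight d z b x' q i u <= C * (size u).+1.
  elim: u q i => //= a u IH q i; rewrite mulnS leq_add //.
  have : `|z q a (marks x' i)|%N <= C.
    exact: (leq_bigmax (F := fun f => `|z f.1.1 f.1.2 f.2|%N) (q, a, marks x' i)).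
  by case: (_ == _); rewrite ?mul1n.
exists (weight d z true (fun r => val (x r)) q0 0 w).
exists (weight d z false (fun r => val (x r)) q0 0 w); split=> //.
move=> a b c j o lt_a lt_b.
refine (runs_seq (g := run_from d (fun r => val (x r)) q0 0 w) _ (runs_ret _ _ _)) => //.
have := @runs_sweep Sigma Gamma reg k Q d z q0 rpos rneg rindex
  (fun r => inl (y r)) w width isT isT isT (fun=> isT) (fun=> isT) (fun=> isT)
  (fun r => val (x r)) (layout (size w) ptr a b c j) o.
rewrite add_weights_layout; apply; rewrite ?ffunE //=.
by move=> r; rewrite ffunE yx.
Qed.

Lemma log_decidable_sign k (y : 'I_k -> X) (Z : position_sum k)
    (f : bool -> bool -> bool) :
  summable y Z -> log_decidable y (fun w x => f (Z w x < 0)%R (Z w x > 0)%R).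
Proof.
case=> [[A C] /= AZ].
exists (seqr A (seqr (compare unit) (seqr (clear rpos)
  (seqr (clear rneg) (ret
    (fun m : unit * {ffun reg * reg -> bool} =>
       f (m.2 (rpos, rneg)) (m.2 (rneg, rpos))))))), C.+1).
move=> w width x ptr c j o /= bound yx.
have lt_w : size w < 2 ^ width.
  by apply: leq_ltn_trans bound; rewrite mulSn addSn leqW // leq_addr.
have lt_C : C * (size w).+1 < 2 ^ width.
  by apply: leq_ltn_trans bound; rewrite mulSn leq_addl.
have [u [v [uvE le_u le_v runA]]] := AZ w width x ptr lt_w yx.
have := runA 0 0 c j o (leq_ltn_trans le_u lt_C) (leq_ltn_trans le_v lt_C).
rewrite !add0n => {}runA; apply: runs_seq runA _.
refine (runs_seq (runs_compare _ (leq0n _)) _).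
refine (runs_seq (runs_clear _ _ (leq0n _)) _).
refine (runs_seq (runs_clear _ _ (leq0n _)) _).
rewrite upd_rpos upd_rneg -uvE.
have -> : f (u%:Z - v%:Z < 0)%R (0 < u%:Z - v%:Z)%R =
    (fun m : unit * {ffun reg * reg -> bool} =>
       f (m.2 (rpos, rneg)) (m.2 (rneg, rpos)))
      (tt, lts (layout (size w) ptr u v c j)).
  by rewrite /= !ffunE /=; congr f; lia.
exact: runs_ret.
Qed.

End Deciders.

(** * The order of the atoms *)

(** An assignment is a function, of which an automaton sees the values only. *)
Lemma models_ext (Sigma : finType) (w : seq Sigma) k (phi : mso Sigma k 0)
    (x x' : 'I_k -> pos w) : x =1 x' -> models phi x = models phi x'.
Proof.
move=> xx'; have [Q [q0 [d [fin run]]]] := recognizable_sat phi.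
rewrite /models !run; congr (fin _); apply/esym/annotated_run_ext => q i.
by congr (d _ _ _ _); apply/ffunP=> r; rewrite !ffunE xx'.
Qed.

Section Rank.
Variables (Sigma : finType) (d : nat) (A : rank_source Sigma d).
Local Open Scope ring_scope.

Fixpoint rank_from (q : rstate A) (u : seq Sigma) (m : nat) : 'rV[int]_d :=
  match u, m with
  | a :: u', m'.+1 => romega q a + rank_from (rdelta q a) u' m'
  | _, _ => 0
  end.

Lemma prefix_rankE w m : prefix_rank A w m = rank_from (rinit A) w m.
Proof.
rewrite /prefix_rank /state_before big_mkcond /=; move: (rinit A) => q.
elim: w q m => [|a w IH] q m /=; first by rewrite big_ord0.
case: m => [|m].
  by rewrite big1 // => j _; rewrite ltn0.
rewrite big_ord_recl /= -IH; congr (_ + _).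
by apply: eq_bigr => j _; rewrite /letter !(tnth_nth a) /= /bump leq0n add1n ltnS.
Qed.

(** The flag tells that the marked letter, where the table is read, has been
    passed. *)
Definition rank_step k (r : 'I_k) (q : rstate A * bool) (a : Sigma)
    (u : {ffun 'I_k -> bool}) : rstate A * bool :=
  (rdelta q.1 a, q.2 || u r).

Definition rank_weight k (r : 'I_k) (e : int) (beta : rstate A -> Sigma -> 'rV_d)
    (i : 'I_d) (q : rstate A * bool) (a : Sigma) (u : {ffun 'I_k -> bool}) : int :=
  if q.2 then 0
  else if u r then e * beta q.1 a ord0 i else e * romega q.1 a ord0 i.

(** [a0] is a default value that is not reached, [x r - m] being the index of a
    letter of [u]. *)
Lemma weight_rank k (r : 'I_k) e beta i (x : 'I_k -> nat) q m (u : seq Sigma) a0 :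
  (m <= x r < m + size u)%N ->
  let z := rank_weight r e beta i in
  (weight (rank_step r) z true x (q, false) m u)%:Z -
  (weight (rank_step r) z false x (q, false) m u)%:Z =
  e * (rank_from q u (x r - m) +
       beta (foldl (@rdelta _ _ A) q (take (x r - m) u)) (nth a0 u (x r - m)))
      ord0 i.
Proof.
move=> + z; elim: u q m => [|a u IH] q m /=; first by lia.
have split_z (v : int) (n n' : nat) : (((0 <= v)%R == true) * `|v|%N + n)%N%:Z -
    (((0 <= v)%R == false) * `|v|%N + n')%N%:Z = v + (n%:Z - n'%:Z).
  by case: v => v /=; lia.
rewrite split_z; case: (ltngtP m (x r)) => //= [lt_m|eq_m] lt_r.
  have step : rank_step r (q, false) a (marks x m) = (rdelta q a, false).
    by rewrite /rank_step /= ffunE gtn_eqF.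
  rewrite step IH; last by lia.
  have -> : (x r - m = (x r - m.+1).+1)%N by lia.
  rewrite /z /rank_weight /= ffunE gtn_eqF //= -mulrDr; congr (_ * _).
  by rewrite !mxE addrA.
have zero b m' q' : weight (rank_step r) z b x (q', true) m' u = 0%N.
  elim: (u) m' q' => //= a' u' IHu m' q'.
  by rewrite /rank_step /= IHu {1}/z /rank_weight /= muln0.
have step : rank_step r (q, false) a (marks x m) = (rdelta q a, true).
  by rewrite /rank_step /= ffunE eq_m eqxx.
rewrite step !zero subrr addr0 eq_m subnn /=.
by rewrite /z /rank_weight /= ffunE eqxx mxE mxE add0r.
Qed.

Lemma summable_rank (Gamma X : finType) k (y : 'I_k -> X) (r : 'I_k) (e : int)
    (beta : rstate A -> Sigma -> 'rV[int]_d) (i : 'I_d) :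
  summable Gamma y (fun w x => e * (prefix_rank A w (x r) +
     beta (state_before A w (x r)) (letter (x r))) ord0 i).
Proof.
apply: summable_ext (summable_run Gamma y (rank_step r)
  (rank_weight r e beta i) (rinit A, false)) => w x.
case: w x => [|a w] x; first by case: (x r).
rewrite (@weight_rank _ _ _ _ _ _ _ _ _ a) /= ?add0n ?ltn_ord // subn0.
rewrite prefix_rankE /letter (tnth_nth a); congr (_ * _).
Qed.

End Rank.

Section Order.
Variables (Sigma Gamma X : finType).
Local Open Scope ring_scope.

Definition lpart (T : Type) k k' (x : 'I_(k + k') -> T) : 'I_k -> T :=
  fun r => x (lshift k' r).
Definition rpart (T : Type) k k' (x : 'I_(k + k') -> T) : 'I_k' -> T :=
  fun r => x (rshift k r).

(** Atoms are compared through differences of coordinates, the two atoms being seen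
    as one tuple of positions. *)
Lemma summable_rank_diff d k k' (K : rank_fun Sigma d k) (K' : rank_fun Sigma d k')
    (y : 'I_(k + k') -> X) (i : 'I_d) :
  summable Gamma y (fun w x => rank_eval K (lpart x) ord0 i -
                               rank_eval K' (rpart x) ord0 i).
Proof.
have sK := summable_big (index_enum 'I_k) (fun r => summable_rank (A := rsource K r)
  Gamma y (lshift k' r) 1 (rbeta (r := r)) i).
have sK' := summable_big (index_enum 'I_k') (fun r => summable_rank (A := rsource K' r)
  Gamma y (rshift k r) (-1) (rbeta (r := r)) i).
have sC := summable_const Sigma Gamma y (rconst K ord0 i - rconst K' ord0 i).
apply: summable_ext (summable_add sC (summable_add sK sK')) => w x.
rewrite /rank_eval !mxE !summxE opprD [RHS]addrACA -sumrN; congr (_ + (_ + _)).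
  by apply: eq_bigr => r _; rewrite mul1r.
by apply: eq_bigr => r _; rewrite mulN1r.
Qed.

Definition atom_of (P : polyreg_data Sigma Gamma) (w : seq Sigma) (c : copy P)
    (x : 'I_(arity c) -> pos w) : atom P w :=
  Tagged (fun c : copy P => {ffun 'I_(arity c) -> pos w}) [ffun r => x r].

Lemma atom_of_lpart (P : polyreg_data Sigma Gamma) w (b a : atom P w) :
  atom_of (lpart (env_cat (tagged b) (tagged a))) = b.
Proof.
case: b => c x; congr Tagged; apply/ffunP=> r.
by rewrite ffunE /lpart /env_cat (unsplitK (inl r)).
Qed.

Lemma atom_of_rpart (P : polyreg_data Sigma Gamma) w (b a : atom P w) :
  atom_of (rpart (env_cat (tagged b) (tagged a))) = a.
Proof.
case: a => c x; congr Tagged; apply/ffunP=> r.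
by rewrite ffunE /rpart /env_cat (unsplitK (inr r)).
Qed.

Lemma rank_eval_ext d k (K : rank_fun Sigma d k) w (x x' : 'I_k -> pos w) :
  x =1 x' -> rank_eval K x = rank_eval K x'.
Proof.
by move=> xx'; congr (_ + _); apply: eq_bigr => r _; rewrite xx'.
Qed.

(** The order is a Boolean combination of the signs of the coordinates of the
    difference of the ranks and of the ordering formula. *)
Lemma log_decidable_wrp_lt (P : wrp Sigma Gamma) (c c' : copy P)
    (y : 'I_(arity c + arity c') -> X) :
  log_decidable Gamma y (fun w x => wrp_lt (atom_of (lpart x)) (atom_of (rpart x))).
Proof.
have sD i := summable_rank_diff (kappa c) (kappa c') y i.
have dlt i := log_decidable_sign (fun b _ => b) (sD i).
have deq i := log_decidable_sign (fun b b' => ~~ b && ~~ b') (sD i).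
have dlex := log_decidable_exists (fun i => log_decidable_bool2 andb (dlt i)
  (log_decidable_forall (fun j : 'I_(rank_dim P) => log_decidable_bool2 implb
    (log_decidable_const Sigma Gamma y (j < i)%N) (deq j)))).
have := log_decidable_bool2 orb dlex (log_decidable_bool2 andb (log_decidable_forall deq)
          (log_decidable_mso Gamma y (ord_formula c c'))).
apply: log_decidable_ext => w x.
have eqE i : ~~ (rank_eval (kappa c) (lpart x) ord0 i -
      rank_eval (kappa c') (rpart x) ord0 i < 0) &&
    ~~ (rank_eval (kappa c) (lpart x) ord0 i -
      rank_eval (kappa c') (rpart x) ord0 i > 0) =
    (rank_eval (kappa c) (lpart x) ord0 i ==
      rank_eval (kappa c') (rpart x) ord0 i).
  by rewrite subr_lt0 subr_gt0 -!leNgt eq_le andbC.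
rewrite /wrp_lt /=.
rewrite (rank_eval_ext _ (ffunE (lpart x))) (rank_eval_ext _ (ffunE (rpart x))).
congr (_ || (_ && _)).
- apply: eq_existsb => i; rewrite subr_lt0; congr (_ && _).
  by apply: eq_forallb => j; rewrite eqE.
- apply/forallP/eqP => [eq_rank|eq_rank i]; last by rewrite eqE eq_rank.
  apply/rowP=> i; apply/eqP; move: (eq_rank i).
  by rewrite eqE.
- apply: models_ext => r; rewrite /env_cat.
  by case: (split_ordP r) => r' ->; rewrite ffunE.
Qed.

End Order.

(** * Loops over positions and atoms *)

Section Loops.
Variables (Sigma Gamma X : finType).
Local Notation reg := (reg X).
Local Notation routine := (routine Sigma Gamma reg).
Local Notation pointers := {ffun X -> nat}.

(** The contents of [rcount] and [rrank], and the output. *)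
Definition progress : Type := (nat * nat * seq Gamma)%type.

Definition for_each (x : X) (body : routine unit unit) : routine unit unit :=
  iterr (seqr (compare unit)
   (premap (fun m : unit * {ffun reg * reg -> bool} =>
      if m.2 (inl x, rsize X) then inl tt else inr tt)
    (caser (seqr body (seqr (incr (fun=> inl x)) (ret inl)))
           (seqr (clear (inl x)) (ret inr))))).

Fixpoint nest k : ('I_k -> X) -> routine unit unit -> routine unit unit :=
  if k is k'.+1 then
    fun y body => for_each (y ord0) (nest (fun r => y (lift ord0 r)) body)
  else fun _ body => body.

Definition ffun_cons k n (i : 'I_n) (x : {ffun 'I_k -> 'I_n}) :
  {ffun 'I_k.+1 -> 'I_n} := [ffun r => env_cons i x r].

Fixpoint all_tuples k n : seq {ffun 'I_k -> 'I_n} :=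
  if k is k'.+1 then
    flatten [seq [seq ffun_cons i x | x <- all_tuples k' n]
            | i <- enum 'I_n]
  else [:: ffun0 (card_ord 0)].

Lemma ffun_cons_eta k n (x : {ffun 'I_k.+1 -> 'I_n}) :
  x = ffun_cons (x ord0) [ffun r => x (lift ord0 r)].
Proof.
apply/ffunP=> r; rewrite ffunE /env_cons.
by case: unliftP => [r' ->|->] //=; rewrite ffunE.
Qed.

Lemma mem_all_tuples k n (x : {ffun 'I_k -> 'I_n}) : x \in all_tuples k n.
Proof.
elim: k x => [|k IH] x /=.
  by rewrite inE; apply/eqP/ffunP=> -[].
apply/flatten_mapP; exists (x ord0); first by rewrite mem_enum.
by apply/mapP; exists [ffun r => x (lift ord0 r)]; rewrite // -ffun_cons_eta.
Qed.

Lemma uniq_all_tuples k n : uniq (all_tuples k n).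
Proof.
elim: k => //= k IH; apply: allpairs_uniq_dep => [|//|].
  exact: enum_uniq.
move=> [i x] [i' x'] _ _ /= eq_x.
have eq_at r := congr1 (fun f : {ffun _} => f r) eq_x.
have := eq_at ord0; rewrite !ffunE /env_cons unlift_none /= => ->.
congr (Tagged _ _); apply/ffunP=> r.
by have := eq_at (lift ord0 r); rewrite !ffunE /env_cons liftK.
Qed.

Definition setp (ptr : pointers) k (y : 'I_k -> X) n (x : 'I_k -> 'I_n) : pointers :=
  [ffun p => if [pick r | y r == p] is Some r then val (x r) else ptr p].

Lemma setpE ptr k (y : 'I_k -> X) n (x : 'I_k -> 'I_n) r :
  injective y -> setp ptr y x (y r) = x r.
Proof.
move=> inj_y; rewrite ffunE; case: pickP => [r' /eqP/inj_y->//|/(_ r)].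
by rewrite eqxx.
Qed.

Lemma setp_out ptr k (y : 'I_k -> X) n (x : 'I_k -> 'I_n) p :
  (forall r, y r != p) -> setp ptr y x p = ptr p.
Proof. by move=> yp; rewrite ffunE; case: pickP => // r; rewrite (negPf (yp r)). Qed.

Section Effects.
Variables (w : seq Sigma) (width : nat).
Local Notation n := (size w).

Definition progresses (Q : routine unit unit) ptr (u u' : progress) : Prop :=
  runs w width Q tt (layout n ptr 0 0 u.1.1 u.1.2) 0 u.2
                 tt (layout n ptr 0 0 u'.1.1 u'.1.2) 0 u'.2.

Lemma progresses_seq Q Q' ptr u u' u'' :
  progresses Q ptr u u' -> progresses Q' ptr u' u'' -> progresses (seqr Q Q') ptr u u''.
Proof. exact: runs_seq. Qed.

Lemma progresses_skip ptr u : progresses (ret id) ptr u u.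
Proof. exact: (runs_ret id). Qed.

(** The condition [ok t u] means that the registers can hold the results for [t]
    more items after [u]; with such budgets, loops compose by concatenation of
    the lists of items they process. *)
Definition effects (T : Type) (ok : nat -> progress -> Prop)
    (eff : T -> progress -> progress) (Q : routine unit unit) ptr (L : seq T) :=
  forall t u, ok (size L + t) u ->
  let u' := foldl (fun u a => eff a u) u L in progresses Q ptr u u' /\ ok t u'.

Lemma effects_nil T ok (eff : T -> _) ptr : effects ok eff (ret id) ptr [::].
Proof. by move=> t u ok_u; split=> //; apply: progresses_skip. Qed.

Lemma effects_cat T ok (eff : T -> _) Q Q' ptr L L' :
  effects ok eff Q ptr L -> effects ok eff Q' ptr L' ->
  effects ok eff (seqr Q Q') ptr (L ++ L').
Proof.
move=> eQ eQ' t u; rewrite size_cat -addnA foldl_cat => /eQ[runQ /eQ'[runQ' ok']].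
by split=> //; apply: progresses_seq runQ runQ'.
Qed.

Lemma updp_id (ptr : pointers) x v : ptr x = v -> updp ptr x v = ptr.
Proof. by move=> <-; apply/ffunP=> x'; rewrite ffunE; case: eqP => // ->. Qed.

Lemma updp_updp (ptr : pointers) x v v' :
  updp (updp ptr x v) x v' = updp ptr x v'.
Proof. by apply/ffunP=> x'; rewrite !ffunE; case: eqP. Qed.

Lemma effects_for T ok (eff : T -> _) body (ptr : pointers) x (L : 'I_n -> seq T) :
  n < 2 ^ width -> ptr x = 0 ->
  (forall i : 'I_n, effects ok eff body (updp ptr x i) (L i)) ->
  effects ok eff (for_each x body) ptr (flatten [seq L i | i <- enum 'I_n]).
Proof.
move=> lt_n ptr_x ebody; rewrite /effects.
(* [s1] lists the positions visited, so that its size is the current one. *)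
suff loop s2 s1 : s1 ++ s2 = enum 'I_n -> forall t u,
    ok (size (flatten [seq L i | i <- s2]) + t) u ->
    let u' := foldl (fun u a => eff a u) u (flatten [seq L i | i <- s2]) in
    runs w width (for_each x body) tt
      (layout n (updp ptr x (size s1)) 0 0 u.1.1 u.1.2) 0 u.2
      tt (layout n ptr 0 0 u'.1.1 u'.1.2) 0 u'.2 /\ ok t u'.
  by have := loop _ [::] erefl; rewrite /progresses [updp _ _ _]updp_id.
elim: s2 s1 => [|i s2 IH] s1 enumE t u ok_u /=.
  split=> //; refine (runs_iter_end _).
  refine (runs_seq (runs_compare _ (leq0n _)) _).
  have <- : n = size s1.
    by rewrite -[LHS]size_enum_ord -enumE cats0.
  refine (runs_premap _); rewrite /= !ffunE /= ffunE eqxx ltnn.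
  refine (runs_caser _ (runs_seq (runs_clear _ _ (leq0n _)) _)).
  rewrite upd_ptr updp_updp [updp _ _ _]updp_id //.
  exact: (runs_ret inr).
have iE : val i = size s1.
  rewrite -[RHS](@nth_enum_ord n i); last first.
    by rewrite -[X in _ < X]size_enum_ord -enumE size_cat /= addnS ltnS leq_addr.
  by rewrite -enumE nth_cat ltnn subnn.
have lt_i : size s1 < n by rewrite -iE; apply: ltn_ord.
have ok_i : ok (size (L i) + (size (flatten [seq L i | i <- s2]) + t)) u.
  by move: ok_u; rewrite /= size_cat addnA.
have [run_i ok_i'] := ebody i _ _ ok_i.
rewrite foldl_cat; set u1 := foldl _ u (L i) in run_i ok_i' *.
have [|run_s ok_s] := IH (rcons s1 i) _ t u1 ok_i'.
  by rewrite cat_rcons.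
split=> //; move: run_s; rewrite size_rcons; apply: runs_iter_next.
refine (runs_seq (runs_compare _ (leq0n _)) _).
refine (runs_premap _); rewrite /= !ffunE /= ffunE eqxx lt_i.
refine (runs_casel _ (runs_seq (s' := layout n (updp ptr x i) 0 0 u1.1.1 u1.1.2)
  (i' := 0) (o' := u1.2) (g := tt) _ _)).
  by move: run_i; rewrite /progresses iE.
pose st := layout n (updp ptr x i) 0 0 u1.1.1 u1.1.2.
have -> : layout n (updp ptr x (size s1).+1) 0 0 u1.1.1 u1.1.2 =
    upd st (inl x) (st (inl x)).+1.
  by rewrite upd_ptr updp_updp ffunE ffunE eqxx iE.
refine (runs_seq (runs_incr (leq0n _) _) (runs_ret _ _ (leq0n _))).
by rewrite ffunE ffunE eqxx iE; apply: leq_ltn_trans lt_n.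
Qed.

Lemma effects_nest T ok (eff : T -> _) k (y : 'I_k -> X) body (ptr : pointers)
    (g : {ffun 'I_k -> 'I_n} -> T) :
  n < 2 ^ width -> injective y -> (forall r, ptr (y r) = 0) ->
  (forall x : {ffun 'I_k -> 'I_n}, effects ok eff body (setp ptr y x) [:: g x]) ->
  effects ok eff (nest y body) ptr [seq g x | x <- all_tuples k n].
Proof.
move=> lt_n; elim: k y ptr g => [|k IH] y ptr g inj_y ptr0 ebody /=.
  have := ebody (ffun0 (card_ord 0)); congr effects.
  by apply/ffunP=> p; rewrite ffunE; case: pickP => // -[].
rewrite map_flatten -map_comp; apply: effects_for => // i /=.
rewrite -map_comp; apply: IH => [r r' /inj_y/lift_inj//|r|x].
  rewrite ffunE ptr0; case: eqP => // /inj_y /eqP.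
  by rewrite eq_sym (negPf (neq_lift _ _)).
have := ebody (ffun_cons i x); congr effects.
apply/ffunP=> p; rewrite !ffunE; case: (pickP (fun r => y r == p)) => [r /eqP<-|y_p].
  rewrite ffunE; case: (unliftP ord0 r) => [r' ->|->].
    case: pickP => [r'' /eqP/inj_y/lift_inj->|/(_ r')]; last by rewrite eqxx.
    by rewrite /env_cons liftK.
  case: pickP => [r'' /eqP/inj_y/eqP|_].
    by rewrite eq_sym (negPf (neq_lift _ _)).
  by rewrite eqxx /env_cons unlift_none.
case: pickP => [r /eqP|_]; first by move: (y_p (lift ord0 r)) => /eqP.
by rewrite eq_sym y_p.
Qed.

Variable P : polyreg_data Sigma Gamma.

Definition for_atoms (y : forall c : copy P, 'I_(arity c) -> X)
    (body : copy P -> routine unit unit) : routine unit unit :=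
  foldr (fun c Q => seqr (nest (y c) (body c)) Q) (ret id) (enum (copy P)).

Definition all_atoms : seq (atom P w) :=
  flatten [seq [seq Tagged (fun c : copy P => {ffun 'I_(arity c) -> pos w}) x
               | x <- all_tuples (arity c) n] | c <- enum (copy P)].

Lemma perm_all_atoms : perm_eq all_atoms (enum (atom P w)).
Proof.
apply: uniq_perm; [|exact: enum_uniq|].
  apply: allpairs_uniq_dep => [|c _|[c x] [c' x'] _ _ //=].
  - exact: enum_uniq.
  - exact: uniq_all_tuples.
move=> [c x]; rewrite mem_enum; apply/flatten_mapP; exists c.
  by rewrite mem_enum.
by apply/mapP; exists x => //; apply: mem_all_tuples.
Qed.

Lemma effects_atoms ok eff (y : forall c : copy P, 'I_(arity c) -> X)
    body (ptr : pointers) :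
  n < 2 ^ width -> (forall c, injective (y c)) ->
  (forall c r, ptr (y c r) = 0) ->
  (forall a : atom P w,
     effects ok eff (body (tag a)) (setp ptr (y (tag a)) (tagged a)) [:: a]) ->
  effects ok eff (for_atoms y body) ptr all_atoms.
Proof.
move=> lt_n inj_y ptr0 ebody; rewrite /for_atoms /all_atoms.
elim: (enum _) => [|c s IH] /=; first exact: effects_nil.
apply: effects_cat => //; apply: effects_nest => // x.
exact: ebody (Tagged _ x).
Qed.

End Effects.
End Loops.

(** * Sorting by counting predecessors *)

Lemma flatten_single (T : eqType) (U : Type) (F : T -> seq U) (L : seq T) a :
  uniq L -> a \in L -> (forall b, b \in L -> b != a -> F b = [::]) ->
  flatten [seq F b | b <- L] = F a.
Proof.
elim: L => //= b L IH /andP[b_L uniq_L]; rewrite inE => /orP[/eqP->|aL] F0.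
  suff -> : flatten [seq F b' | b' <- L] = [::] by rewrite cats0.
  have {IH uniq_L F0} : forall b', b' \in L -> F b' = [::].
    move=> b' b'L; rewrite F0 ?inE ?b'L ?orbT //.
    by apply: contraNneq b_L => <-.
  elim: L {b_L} => //= b' L IH F0.
  by rewrite F0 ?mem_head // IH // => b'' b''L; rewrite F0 ?inE ?b''L ?orbT.
rewrite F0 ?mem_head //=; last by apply: contraNneq b_L => ->.
by apply: IH => // b' b'L; apply: F0; rewrite inE b'L orbT.
Qed.

Lemma flatten_nil (T : eqType) (U : Type) (F : T -> seq U) (L : seq T) :
  (forall b, b \in L -> F b = [::]) -> flatten [seq F b | b <- L] = [::].
Proof.
elim: L => //= b L IH F0.
by rewrite F0 ?mem_head // IH // => b' b'L; rewrite F0 ?inE ?b'L ?orbT.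
Qed.

Section SortByRank.
Variables (T : finType) (A : {set T}) (r : rel T).
Hypothesis r_linear : strict_linear_on A r.
Variable L : seq T.
Hypothesis L_all : perm_eq L (enum T).

Definition number_below (a : T) : nat := count (fun b => (b \in A) && r b a) L.

Let s := sort (fun a b => (a == b) || r a b) (enum A).

Lemma mem_sorted a : (a \in s) = (a \in A).
Proof. by rewrite mem_sort mem_enum. Qed.

Lemma number_below_sorted s1 a s2 : s = s1 ++ a :: s2 -> number_below a = size s1.
Proof.
case: r_linear => irr tr tot sE.
have aA : a \in A by rewrite -mem_sorted sE mem_cat mem_head orbT.
have sA b : b \in s -> b \in A by rewrite mem_sorted.
have -> : number_below a = count (r^~ a) s.
  rewrite /number_below (permP L_all) -[RHS]size_filter.
  rewrite -(@perm_size _ [seq b <- enum A | r b a]); last first.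
    by apply: perm_filter; rewrite perm_sym perm_sort.
  rewrite enumT /enum_mem -filter_predI size_filter.
  by apply: eq_count => b; rewrite /= andbC.
have srt : pairwise (fun a b => (a == b) || r a b) s.
  rewrite -(sorted_pairwise_in (P := mem A)).
  - apply: (sort_sorted_in (P := mem A)) => [b c bA cA|].
      case: (eqVneq b c) => //= bc.
      by have /orP[->//|->] := tot b c bA cA bc; rewrite ?orbT.
    by apply/allP=> b; rewrite mem_enum.
  - move=> b c d bA cA dA /= /orP[/eqP->//|cb] /orP[/eqP<-|bd]; first by rewrite cb orbT.
    by rewrite (tr b) ?orbT.
  - by apply/allP=> b /sA.
have := sort_uniq (fun a b => (a == b) || r a b) (enum A).
rewrite enum_uniq -/s; move: srt; rewrite sE.
rewrite pairwise_cat pairwise_cons => /and3P[/allrelP s1_lt _ /andP[/allP s2_gt _]].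
rewrite cat_uniq /= => /and3P[_ a_s1 /andP[a_s2 _]].
rewrite count_cat /= irr // add0n.
have -> : count (r^~ a) s2 = 0.
  apply/eqP; rewrite -leqn0 leqNgt -has_count; apply/hasPn => b b_s2.
  have bA : b \in A by apply: sA; rewrite sE mem_cat inE b_s2 !orbT.
  apply/negP=> ba; have := s2_gt _ b_s2.
  case: eqVneq => [ab|_ /= ab]; first by rewrite ab b_s2 in a_s2.
  by have := irr a aA; rewrite (tr b).
rewrite addn0; apply/eqP; rewrite -all_count; apply/allP=> b b_s1.
have := s1_lt b a b_s1 (mem_head _ _); case: eqVneq => [ba|//].
by move: a_s1; rewrite negb_or -ba b_s1.
Qed.

(** Round [j] finds the item with [j] predecessors; the rounds after the last item
    find nothing. *)
Lemma flatten_by_rank (U : Type) (F : T -> seq U) N : size s <= N ->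
  flatten [seq flatten [seq if (a \in A) && (number_below a == j) then F a else [::]
                       | a <- L] | j <- iota 0 N] =
  flatten [seq F a | a <- s].
Proof.
move=> le_N; have uniq_L : uniq L by rewrite (perm_uniq L_all) enum_uniq.
have mem_L a : a \in L by rewrite (perm_mem L_all) mem_enum.
have below_nth a0 i : i < size s -> number_below (nth a0 s i) = i.
  move=> lt_i; rewrite (@number_below_sorted (take i s) _ (drop i.+1 s)).
    by rewrite size_takel // ltnW.
  by rewrite -drop_nth // cat_take_drop.
rewrite -(subnKC le_N) iotaD map_cat flatten_cat add0n [X in _ ++ X]flatten_nil.
  case sE: s (below_nth) => [//|a0 s'] /(_ a0); rewrite -sE => below.
  rewrite cats0 -[in RHS](mkseq_nth a0 s) /mkseq -map_comp; congr flatten.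
  apply/eq_in_map => j; rewrite mem_iota add0n => /andP[_ lt_j] /=.
  rewrite (@flatten_single _ _ _ _ (nth a0 s j)) //.
    by rewrite below // eqxx -mem_sorted mem_nth.
  move=> a _ ne_a; case: ifP => // /andP[]; rewrite -mem_sorted => aS.
  case/eqP=> below_a; case/eqP: ne_a.
  by rewrite -below_a -[in number_below _](nth_index a0 aS) below ?index_mem // nth_index.
move=> j; rewrite mem_iota => /andP[le_j _]; apply: flatten_nil => a _.
case: ifP => // /andP[]; rewrite -mem_sorted => aS /eqP below_a.
have : number_below a < size s.
  by rewrite -[X in number_below X](nth_index a aS) below_nth index_mem.
by rewrite below_a ltnNge le_j.
Qed.

End SortByRank.

(** ** Lexicographic order *)

Section Lex.
Variable d : nat.
Implicit Types u v t : 'rV[int]_d.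

Lemma lex_lt_irr u : lex_lt u u = false.
Proof. by apply/existsP => -[i]; rewrite ltxx. Qed.

Lemma lex_lt_trans : transitive (@lex_lt d).
Proof.
move=> v u t /existsP[i /andP[uv_i /forallP uv]] /existsP[i' /andP[vt_i /forallP vt]].
case: (ltngtP i i') => [lt_i|gt_i|/val_inj eq_i].
- apply/existsP; exists i; rewrite -(eqP (implyP (vt i) lt_i)) uv_i /=.
  apply/forallP=> j; apply/implyP=> lt_j; rewrite (eqP (implyP (uv j) lt_j)).
  exact: implyP (vt j) (ltn_trans lt_j lt_i).
- apply/existsP; exists i'; rewrite (eqP (implyP (uv i') gt_i)) vt_i /=.
  apply/forallP=> j; apply/implyP=> lt_j.
  rewrite (eqP (implyP (uv j) (ltn_trans lt_j gt_i))).
  exact: implyP (vt j) lt_j.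
- apply/existsP; exists i; rewrite (lt_trans uv_i) ?eq_i //=.
  apply/forallP=> j; apply/implyP=> lt_j; rewrite (eqP (implyP (uv j) _)) ?eq_i //.
  exact: implyP (vt j) lt_j.
Qed.

Lemma lex_lt_total u v : u != v -> lex_lt u v || lex_lt v u.
Proof.
move=> ne_uv; have [i0 ne_i0] : exists i, u ord0 i != v ord0 i.
  apply/existsP; apply: contraR ne_uv; rewrite negb_exists => /forallP eq_uv.
  by apply/eqP/rowP=> i; apply/eqP; move: (eq_uv i); rewrite negbK.
case: (@arg_minnP _ i0 (fun i => u ord0 i != v ord0 i) val ne_i0) => i ne_i min_i.
have eq_j (j : 'I_d) : (j < i)%N -> u ord0 j = v ord0 j.
  by move=> lt_j; apply/eqP; apply: contraTT lt_j => /min_i; rewrite -leqNgt.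
have /orP[lt_i|lt_i] : (u ord0 i < v ord0 i)%R || (v ord0 i < u ord0 i)%R.
- by rewrite -neq_lt.
- apply/orP; left; apply/existsP; exists i; rewrite lt_i /=.
  by apply/forallP=> j; apply/implyP=> /eq_j ->.
- apply/orP; right; apply/existsP; exists i; rewrite lt_i /=.
  by apply/forallP=> j; apply/implyP=> /eq_j ->.
Qed.

End Lex.

Lemma wrp_lt_linear (Sigma Gamma : finType) (P : wrp Sigma Gamma) w :
  strict_linear_on (selected P w) (@wrp_lt _ _ P w).
Proof.
have [irr tr tot] := chi_linear P w; split=> [a aS|b a c bS aS cS|a b aS bS ne].
- by rewrite /wrp_lt lex_lt_irr eqxx irr.
- rewrite /wrp_lt => /orP[ab|/andP[/eqP-> ab]] /orP[bc|/andP[/eqP<- bc]].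
  + by rewrite (lex_lt_trans ab bc).
  + by rewrite ab.
  + by rewrite bc.
  + by rewrite eqxx (tr b) ?orbT.
- rewrite /wrp_lt; set ka := rank_eval _ (tagged a); set kb := rank_eval _ (tagged b).
  rewrite [kb == ka]eq_sym; case: (eqVneq ka kb) => [->|ne_k] /=.
    by rewrite lex_lt_irr /= tot.
  by have /orP[->//|->] := lex_lt_total ne_k; rewrite !orbT.
Qed.

(** * From routines to transducers *)

Section Transducer.
Variables (Sigma Gamma R : finType) (P : routine Sigma Gamma R unit bool).

Lemma accept_reject : (inr true : point P + bool) != inr false.
Proof. by []. Qed.

Definition transducer_of : transducer Sigma Gamma :=
  @Transducer Sigma Gamma (point P + bool)%type (inl (entry P tt)) (inr true)
    (inr false) accept_reject unit (symbol R) None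
    (fun q a b => match q with
     | inl s => let: (c, dir, act, out) := trans s a (b tt) in
         (c, dir, [ffun=> act], out)
     | inr b => (inr b, Stay, [ffun=> (None, Stay)], None)
     end).

Variables (w : seq Sigma) (width : nat).

(** Configurations are compared tape by tape, functions being intensional. *)
Definition agrees (c : point P + bool) (m : memory Gamma R)
    (cfg : config transducer_of) : Prop :=
  [/\ cstate cfg = c, cinput cfg = mhead m,
      forall t, cwork cfg t = mtape m & coutput cfg = mout m].

Lemma space_agrees c m cfg : agrees c m cfg ->
  space cfg = maxn (size (cells (mtape m))) (head_at (mtape m)).+1.
Proof.
by case=> _ _ tp _; rewrite /space (bigD1 tt) //= big1 ?addn0 ?tp // => -[].
Qed.

Lemma agrees_step s m cfg : agrees (inl s) m cfg ->
  agrees (mstep w s m).1 (mstep w s m).2 (step w cfg).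
Proof.
case=> st inp tp out; rewrite /step st /= /mstep ffunE tp inp.
case: trans => [[[c dir] act] o] /=.
by split=> //= [t|]; rewrite ?tp ?ffunE ?out.
Qed.

Lemma iter_step_halted b m cfg n :
  agrees (inr b) m cfg -> iter n (step w) cfg = cfg.
Proof.
case=> st _ _ _; elim: n => //= n ->; rewrite /step st.
by case: b {st}.
Qed.

Lemma reach_config c m b m' cfg :
  reach w width (P := P) c m (inr b) m' -> agrees c m cfg ->
  (exists n, agrees (inr b) m' (iter n (step w) cfg)) /\
  (forall n, space (iter n (step w) cfg) <= width.+2).
Proof.
move Ec : (inr b) => c' rch; elim: rch cfg Ec => {c m c' m'}.
  move=> c m fm cfg <- ag; split; first by exists 0.
  by move=> n; rewrite (iter_step_halted _ ag) (space_agrees ag).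
move=> s m c' m' fm _ IH cfg Ec ag.
have [[n ag'] sp] := IH _ Ec (agrees_step ag); split.
  by exists n.+1; rewrite iterSr.
by case=> [|k]; [rewrite (space_agrees ag)|rewrite iterSr].
Qed.

End Transducer.

Definition initial_memory Gamma R : memory Gamma R := Memory 0 (Tape [::] 0) [::].

Lemma logspace_of_routine (Sigma Gamma R : finType)
    (P : routine Sigma Gamma R unit bool) T K :
  (forall w, exists2 m, odflt (mout m) (T w) = mout m &
     reach w (K * maxn 1 (trunc_log 2 (size w))) (inl (entry P tt))
       (initial_memory Gamma R) (inr (T w : bool)) m) ->
  logspace_computable T.
Proof.
move=> runP; exists (transducer_of P).
have ag : agrees (P := P) (inl (entry P tt)) (initial_memory Gamma R)
  (init_config (transducer_of P)) by [].
split=> [w|].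
  have [m out rch] := runP w; have [[n [st _ _ out']] _] := reach_config rch ag.
  exists n; rewrite /config_after /= in out' st *; rewrite out' st.
  by case: (T w) out => [v|].
exists K.+2 => w n; have [m _ rch] := runP w.
have [_ sp] := reach_config rch ag; apply: leq_trans (sp n) _.
by rewrite -addn2 -[K.+2]addn2 mulnDl leq_add2l; lia.
Qed.

(** As [n.+1 <= 2 ^ (2 * l)] for the logarithm [l], where the factor 2 pays for
    rounding it down. *)
Lemma ltn_width C m n :
  C * n.+1 ^ m < 2 ^ ((C + 2 * m) * maxn 1 (trunc_log 2 n)).
Proof.
set l := maxn 1 (trunc_log 2 n); have l_gt0 : 0 < l by rewrite leq_max.
have lt_n : n.+1 <= 2 ^ (2 * l).
  case: n @l l_gt0 => [|n] l l_gt0; first by rewrite expn_gt0.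
  apply: leq_trans (trunc_log_ltn _ (isT : 1 < 2)) _.
  by rewrite leq_exp2l // mul2n -addnn -addn1 addnC leq_add // leq_maxr.
rewrite mulnDl expnD; apply: (@leq_ltn_trans (C * 2 ^ (2 * m * l))).
  rewrite leq_mul2l -mulnA [m * l]mulnC mulnA expnM.
  case: m => [|m]; first by rewrite !expn0 orbT.
  by rewrite leq_exp2r // lt_n orbT.
rewrite ltn_pmul2r ?expn_gt0 //; apply: leq_trans (ltn_expl _ (isT : 1 < 2)) _.
by rewrite leq_exp2l // leq_pmulr.
Qed.

Section Program.
Variables (Sigma Gamma X : finType).
Local Notation routine := (routine Sigma Gamma (reg X)).

(** On a blank tape the mark alone represents registers that are all zero. *)
Definition write_mark : routine unit unit :=
  @Routine Sigma Gamma (reg X) unit unit unit id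
    (fun _ _ _ => (inr tt, Stay, (Some None, Stay), None)).

(** A sweep where all weights are one computes the length of the input. *)
Definition start : routine unit unit :=
  seqr (sweep (k := 0) (fun (_ : unit) _ _ => tt) (fun _ _ _ => 1%R : int) tt
          (rsize X) (rneg X) (rindex X) (fun r => rsize X))
       (ret (fun=> tt)).

Lemma runs_start w width o : size w < 2 ^ width ->
  runs w width start tt (layout 0 [ffun=> 0] 0 0 0 0) 0 o
       tt (layout (size w) [ffun=> 0] 0 0 0 0) 0 o.
Proof.
move=> lt_w; refine (runs_seq (g := tt) _ (runs_ret _ _ (leq0n _))).
pose z (_ : unit) (_ : Sigma) (_ : {ffun 'I_0 -> bool}) := 1%R : int.
pose d (_ : unit) (_ : Sigma) (_ : {ffun 'I_0 -> bool}) := tt.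
have w1 x i (u : seq Sigma) : weight d z true x tt i u = size u.
  by elim: u i => //= a u IH i; rewrite IH.
have w0 x i (u : seq Sigma) : weight d z false x tt i u = 0.
  by elim: u i => //= a u IH i; rewrite IH.
have := @runs_sweep Sigma Gamma (reg X) 0 unit d z tt (rsize X) (rneg X) (rindex X)
  (fun=> rsize X) w width isT isT isT.
have no (Q : 'I_0 -> Prop) : forall r, Q r by case.
move/(_ (no _) (no _) (no _) (fun=> 0) (layout 0 [ffun=> 0] 0 0 0 0) o (no _)).
rewrite w1 w0 !ffunE /= addn0; case: (run_from _ _ _ _ _).
have -> : add_weights (rsize X) (rneg X) (rindex X)
   (layout 0 [ffun=> 0] 0 0 0 0) 0 (size w) 0 =
   layout (size w) [ffun=> 0] 0 0 0 0.
  apply/ffunP=> -[x|[[|[|[|[|[|[|//]]]]]] lt_i]]; rewrite !ffunE /=;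
  by rewrite ?muln0 ?mul0n ?mul1n ?addn0.
by apply; rewrite ?expn_gt0.
Qed.

Lemma logspace_program (Q : routine unit bool) T K :
  (forall w, let width := K * maxn 1 (trunc_log 2 (size w)) in
     size w < 2 ^ width /\
     exists s i o, odflt o (T w) = o /\
     runs w width Q tt (layout (size w) [ffun=> 0] 0 0 0 0) 0 [::]
       (T w : bool) s i o) ->
  logspace_computable T.
Proof.
move=> runQ; apply: (@logspace_of_routine _ _ _
  (seqr write_mark (seqr start Q)) T K) => w.
have [lt_w [s [i [o [oE {}runQ]]]]] := runQ w.
set width := K * _ in lt_w runQ *.
have [m repm reachm] : exists2 m,
    represents width (layout 0 [ffun=> 0] 0 0 0 0) 0 [::] m &
    reach w width (P := seqr write_mark (seqr start Q))
      (inl (entry (seqr write_mark (seqr start Q)) tt)) (initial_memory Gamma (reg X))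
      (inl (inr (entry (seqr start Q) tt))) m.
  exists (Memory 0 (Tape [:: Some None] 0) [::]).
    exists [::]; first by split=> // -[|[]].
    by split=> // -[x|[[|[|[|[|[|[|//]]]]]] lt_i]]; rewrite !ffunE.
  apply: reach_step; first by rewrite /fits /=.
  rewrite /mstep /= min0n; apply: reach_refl.
  by rewrite /fits /=.
have [m' repm' reachm'] := runs_seq (runs_start lt_w) runQ repm.
have [_ _ [_ _ out' _ _]] := repm'.
exists m'; first by rewrite out'.
apply: reach_trans reachm _.
pose P := seqr write_mark (seqr start Q).
pose embed c : point P + bool :=
  match c with inl s => inl (inr s) | inr h => inr h end.
exact: (@reach_embed _ _ _ w width _ _ _ _ (seqr start Q) P embed inr _ _ _ _ _ _ reachm').
Qed.

End Program.

(** * A map with a nonregular domain *)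

Lemma sentence_regular (Sigma : finType) (phi : mso Sigma 0 0) :
  exists (Q : finType) (q0 : Q) (f : Q -> Sigma -> Q) (fin : pred Q),
  forall w, models_sentence w phi = fin (foldl f q0 w).
Proof.
have [Q [q0 [d [fin run]]]] := recognizable_sat phi.
exists Q, q0, (fun q a => d q a [ffun=> false] [ffun=> false]), fin => w.
rewrite /models_sentence /models run; congr (fin _).
set x := widen_ord _.
have foldE u i q : run_from (fun q a u => d q a u [ffun=> false])
    (fun r => val (x r)) q i u =
    foldl (fun q a => d q a [ffun=> false] [ffun=> false]) q u.
  elim: u i q => //= a u IH i q; rewrite IH; congr foldl.
  by congr (d _ _ _ _); apply/ffunP=> -[].
rewrite -(foldE w 0) run_from_enum; apply/esym/annotated_run_ext => q i.
by congr (d _ _ _ _); apply/ffunP=> -[].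
Qed.

Definition balanced (w : seq bool) : bool := count_mem true w == count_mem false w.

(** The values are trivial: the domain alone separates the classes. *)
Definition balanced_map (w : seq bool) : option (seq bool) :=
  if balanced w then Some [::] else None.

(** Among [#|Q|.+1] words of letters [true] of different lengths two lead to the
    same state, although they need different numbers of letters [false]. *)
Lemma balanced_nonregular (phi : mso bool 0 0) :
  ~ (forall w, models_sentence w phi = balanced w).
Proof.
have [Q [q0 [f [fin run]]]] := sentence_regular phi => phiE.
pose g (i : 'I_#|Q|.+1) := foldl f q0 (nseq i true).
have /injectivePn[i [j ne_ij eq_g]] : ~~ injectiveb g.
  by apply/injectiveP => /leq_card; rewrite card_ord ltnn.
have balE k l : fin (foldl f q0 (nseq k true ++ nseq l false)) = (k == l).
  rewrite -run phiE /balanced !count_cat !count_nseq /=.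
  by rewrite !mul1n !mul0n addn0.
have := balE i i; rewrite eqxx foldl_cat -/(g i) eq_g -foldl_cat balE.
by rewrite eq_sym => /eqP/val_inj/eqP; rewrite (negPf ne_ij).
Qed.

Lemma balanced_map_not_wrp : ~ is_wrp balanced_map.
Proof.
case=> P TE; apply: (@balanced_nonregular (dom_formula P)) => w.
have := TE w; rewrite /balanced_map /wrp_map.
by case: (balanced w); case: ifP.
Qed.

Lemma log_decidable_balanced (y : 'I_0 -> void) :
  log_decidable bool y (fun w _ => balanced w).
Proof.
pose d (_ : unit) (_ : bool) (_ : {ffun 'I_0 -> bool}) := tt.
pose z (_ : unit) (a : bool) (_ : {ffun 'I_0 -> bool}) : int :=
  if a then 1%R else (-1)%R.
have weightE b x i w : weight d z b x tt i w = count_mem b w.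
  by elim: w i => //= a w IH i; rewrite IH; case: a b {IH} => [] [].
have := log_decidable_sign (fun b b' => ~~ b && ~~ b') (summable_run bool y d z tt).
apply: log_decidable_ext => w x; rewrite !weightE /balanced; lia.
Qed.

Lemma logspace_balanced_map : logspace_computable balanced_map.
Proof.
have no (T : Type) (i : 'I_0) : T by case: i.
have [[D C] /= DP] := log_decidable_balanced (no _).
apply: (logspace_program (Q := D) (K := C.+3)) => w /=.
have := ltn_width C.+1 1 (size w); rewrite expn1 addn2; set width := _ * maxn _ _ => lt_w.
split; first by apply: leq_ltn_trans lt_w; rewrite mulSn addSn leqW // leq_addr.
exists (layout (size w) [ffun=> 0] 0 0 0 0), 0, [::].
split; first by rewrite /balanced_map; case: ifP.
have -> : (balanced_map w : bool) = balanced w.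
  by rewrite /balanced_map; case: ifP.
apply: (DP w width (no _)) => [|r]; last exact: (no _ r).
by apply: leq_ltn_trans lt_w; rewrite mulSn leq_addl.
Qed.

(** * Presentations are computed in logarithmic space *)

Section Presentation.
Variables (Sigma Gamma : finType) (P : wrp Sigma Gamma).

Definition max_arity : nat := \max_(c : copy P) arity c.
Definition pointer : finType := ('I_3 * 'I_max_arity.+1)%type.

(** Three atoms are held at a time: the one that may be written, the ones it is
    compared with, and one that only counts the rounds. *)
Definition slot (s : 'I_3) (c : copy P) (r : 'I_(arity c)) : pointer :=
  (s, inord r).
Definition written : 'I_3 := @Ordinal 3 0 isT.
Definition compared : 'I_3 := @Ordinal 3 1 isT.
Definition round : 'I_3 := @Ordinal 3 2 isT.

Lemma slot_inj s c : injective (@slot s c).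
Proof.
have le_c (r : 'I_(arity c)) : r < max_arity.+1.
  rewrite ltnS; apply: leq_trans (ltnW (ltn_ord r)) _.
  exact: (leq_bigmax (F := fun c : copy P => arity c)).
by move=> r r' [] /(congr1 val); rewrite /= !inordK //; apply: val_inj.
Qed.

Lemma slot_neq s s' c c' r r' : s != s' -> @slot s c r != @slot s' c' r'.
Proof. by apply: contraNneq => -[->]. Qed.

Local Notation reg := (reg pointer).
Local Notation routine := (routine Sigma Gamma reg).
Local Notation skip := (ret id : routine unit unit).

Variable Dsel : 'I_3 -> copy P -> routine unit bool.
Variable Dlab : copy P -> Gamma -> routine unit bool.
Variable Dlt : copy P -> copy P -> routine unit bool.
Variable Ddom : routine unit bool.

Definition count_below (c : copy P) : routine unit unit :=
  for_atoms (@slot compared) (fun c' =>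
    branch (branch (incr (fun=> rcount pointer)) skip (Dlt c' c)) skip
           (Dsel compared c')).

Definition emit (c : copy P) : routine unit unit :=
  foldr (fun g Q => seqr
     (branch (act (fun _ _ => (tt, Stay, Some g))) skip (Dlab c g)) Q)
    skip (enum Gamma).

Definition emit_ranked (c : copy P) : routine unit unit :=
  branch
    (seqr (count_below c) (seqr (compare unit) (seqr
      (premap (fun m : unit * {ffun reg * reg -> bool} =>
         if ~~ m.2 (rcount pointer, rrank pointer) &&
            ~~ m.2 (rrank pointer, rcount pointer) then inl tt else inr tt)
       (caser (emit c) skip))
      (clear (rcount pointer)))))
    skip (Dsel written c).

(** The rounds, which are as many as the atoms, are counted by a loop over the
    atoms itself. *)
Definition emit_all : routine unit unit :=
  for_atoms (@slot round) (fun=>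
    seqr (for_atoms (@slot written) emit_ranked) (incr (fun=> rrank pointer))).

Definition main : routine unit bool :=
  branch (seqr emit_all (ret (fun=> true))) (ret (fun=> false)) Ddom.

Section Correctness.
Variables (w : seq Sigma) (width : nat).
Local Notation n := (size w).
Local Notation pointers := {ffun pointer -> nat}.
Local Notation L := (all_atoms w P).

Definition at_slot (s : 'I_3) (a : atom P w) (ptr : pointers) : Prop :=
  forall r, ptr (@slot s (tag a) r) = tagged a r.

Definition free (s : 'I_3) (ptr : pointers) : Prop :=
  forall c r, ptr (@slot s c r) = 0.

Definition answers (ptr : pointers) (D : routine unit bool) (b : bool) : Prop :=
  forall c j o, runs w width D tt (layout n ptr 0 0 c j) 0 o
                               b (layout n ptr 0 0 c j) 0 o.

Hypothesis sel_ok : forall s (a : atom P w) ptr,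
  at_slot s a ptr -> answers ptr (Dsel s (tag a)) (a \in selected P w).
Hypothesis lab_ok : forall (a : atom P w) g ptr,
  at_slot written a ptr -> answers ptr (Dlab (tag a) g) (has_label a g).
Hypothesis lt_ok : forall (b a : atom P w) ptr,
  at_slot compared b ptr -> at_slot written a ptr ->
  answers ptr (Dlt (tag b) (tag a)) (wrp_lt b a).
Hypothesis dom_ok : forall ptr,
  answers ptr Ddom (models_sentence w (dom_formula P)).
Hypothesis lt_n : n < 2 ^ width.
Hypothesis lt_L : size L < 2 ^ width.

Lemma progresses_branch Q Q' D b ptr u u' :
  answers ptr D b -> progresses w width (if b then Q else Q') ptr u u' ->
  progresses w width (branch Q Q' D) ptr u u'.
Proof. by move=> ansD; apply: runs_branch. Qed.

Lemma at_slot_setp s (a : atom P w) ptr :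
  at_slot s a (setp ptr (@slot s (tag a)) (tagged a)).
Proof. by move=> r; rewrite setpE //; apply: slot_inj. Qed.

Lemma at_slot_other s s' (a b : atom P w) ptr : s' != s ->
  at_slot s a ptr -> at_slot s a (setp ptr (@slot s' (tag b)) (tagged b)).
Proof. by move=> ne_s at_a r; rewrite setp_out // => r'; apply: slot_neq. Qed.

Lemma free_other s s' (b : atom P w) ptr : s' != s ->
  free s ptr -> free s (setp ptr (@slot s' (tag b)) (tagged b)).
Proof. by move=> ne_s fr c r; rewrite setp_out // => r'; apply: slot_neq. Qed.

Local Notation below a := (number_below (selected P w) (@wrp_lt _ _ P w) L a).

Lemma runs_count_below (a : atom P w) ptr j o :
  at_slot written a ptr -> free compared ptr ->
  progresses w width (count_below (tag a)) ptr (0, j, o) (below a, j, o).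
Proof.
move=> at_a fr.
pose ok t (u : progress Gamma) := u.1.1 + t < 2 ^ width.
pose eff (b : atom P w) (u : progress Gamma) : progress Gamma :=
  (u.1.1 + ((b \in selected P w) && wrp_lt b a), u.1.2, u.2).
have [||] := @effects_atoms Sigma Gamma pointer w width P ok eff (@slot compared)
  (fun c' => branch (branch (incr (fun=> rcount pointer)) skip (Dlt c' (tag a)))
    skip (Dsel compared c')) ptr lt_n (@slot_inj _) fr _ 0 (0, j, o).
- move=> b t [[c j'] o'] /=; rewrite /ok /= addSn add0n => lt_c.
  split; last by move: lt_c; case: (_ && _) => /=; lia.
  apply: progresses_branch (sel_ok (at_slot_setp _ _)) _ => /=.
  rewrite /eff /=; case: (b \in selected P w) => /=; last first.
    by rewrite addn0; apply: progresses_skip.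
  apply: progresses_branch (lt_ok (at_slot_setp _ _) (at_slot_other _ _ at_a)) _ => //.
  case: (wrp_lt b a) => /=; last by rewrite addn0; apply: progresses_skip.
  rewrite /progresses /= addn1 -(upd_rcount _ _ _ _ c _ c.+1).
  have := @runs_incr Sigma Gamma reg w width unit (fun=> rcount pointer) tt
    (layout n (setp ptr (@slot compared (tag b)) (tagged b)) 0 0 c j') 0 o' (leq0n _).
  by rewrite ffunE /=; apply; lia.
- by rewrite /ok /= addn0.
have foldE s u : foldl (fun u b => eff b u) u s =
    (u.1.1 + count (fun b => (b \in selected P w) && wrp_lt b a) s, u.1.2, u.2).
  elim: s u => [|b s IH] [[c j'] o'] /=; first by rewrite addn0.
  by rewrite IH /= addnA.
by rewrite foldE /= add0n.
Qed.

Definition labels (a : atom P w) : seq Gamma := [seq g <- enum Gamma | has_label a g].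

Lemma runs_emit (a : atom P w) ptr u : at_slot written a ptr ->
  progresses w width (emit (tag a)) ptr u (u.1, u.2 ++ labels a).
Proof.
move=> at_a; rewrite /emit /labels; elim: (enum Gamma) u => [|g s IH] [[c j] o] /=.
  by rewrite cats0; apply: progresses_skip.
case: ifP => lab_g; last first.
  refine (progresses_seq _ (IH (c, j, o))); apply: progresses_branch (lab_ok g at_a) _.
  by rewrite lab_g; apply: progresses_skip.
rewrite -cat_rcons; refine (progresses_seq _ (IH (c, j, rcons o g))).
apply: progresses_branch (lab_ok g at_a) _; rewrite lab_g.
by apply: (runs_act (dir := Stay) (out := Some g)).
Qed.

Definition ranked (j : nat) (a : atom P w) : seq Gamma :=
  if (a \in selected P w) && (below a == j) then labels a else [::].

Lemma runs_emit_ranked (a : atom P w) ptr j o :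
  at_slot written a ptr -> free compared ptr ->
  progresses w width (emit_ranked (tag a)) ptr (0, j, o) (0, j, o ++ ranked j a).
Proof.
move=> at_a fr; apply: progresses_branch (sel_ok at_a) _; rewrite /ranked.
case: (a \in selected P w) => /=; last by rewrite cats0; apply: progresses_skip.
refine (progresses_seq (runs_count_below at_a fr) _).
refine (runs_seq (runs_compare _ (leq0n _)) _).
refine (runs_seq (s' := layout n ptr 0 0 (below a) j) (i' := 0) (g := tt)
  (o' := o ++ (if below a == j then labels a else [::])) (runs_premap _) _).
  rewrite /= !ffunE /= -!leqNgt -eqn_leq eq_sym.
  case: eqP => _; last by rewrite cats0; refine (runs_caser _ (runs_ret _ _ (leq0n _))).
  exact: (runs_casel _ (runs_emit (u := (below a, j, o)) at_a)).
rewrite /= -(upd_rcount _ _ _ _ (below a) j 0).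
exact: runs_clear.
Qed.

Definition block (j : nat) : seq Gamma := flatten [seq ranked j a | a <- L].

Lemma runs_block ptr j o : free written ptr -> free compared ptr ->
  progresses w width (for_atoms (@slot written) emit_ranked) ptr
    (0, j, o) (0, j, o ++ block j).
Proof.
move=> fr fr'; pose ok (t : nat) (u : progress Gamma) := u.1.1 = 0.
pose eff (a : atom P w) (u : progress Gamma) : progress Gamma :=
  (u.1, u.2 ++ ranked u.1.2 a).
have [||] := @effects_atoms Sigma Gamma pointer w width P ok eff (@slot written)
  emit_ranked ptr lt_n (@slot_inj _) fr _ 0 (0, j, o) => //.
  move=> a t [[c j'] o']; rewrite /ok /= => ->; split=> //.
  by apply: runs_emit_ranked; [apply: at_slot_setp|apply: free_other].
have foldE s u : foldl (fun u b => eff b u) u s =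
    (u.1, u.2 ++ flatten [seq ranked u.1.2 a | a <- s]).
  elim: s u => [|b s IH] [[c j'] o'] /=; first by rewrite cats0.
  by rewrite IH /= catA.
by rewrite foldE.
Qed.

Lemma runs_emit_all : progresses w width emit_all [ffun=> 0] (0, 0, [::])
  (0, size L, flatten [seq block j | j <- iota 0 (size L)]).
Proof.
have fr s : free s [ffun=> 0] by move=> c r; rewrite ffunE.
pose ok (t : nat) (u : progress Gamma) := u.1.1 = 0 /\ u.1.2 + t < 2 ^ width.
pose eff (a : atom P w) (u : progress Gamma) : progress Gamma :=
  (u.1.1, u.1.2.+1, u.2 ++ block u.1.2).
have [||] := @effects_atoms Sigma Gamma pointer w width P ok eff (@slot round)
  (fun=> seqr (for_atoms (@slot written) emit_ranked)
    (incr (fun=> rrank pointer))) [ffun=> 0] lt_n (@slot_inj _) (fr _) _ 0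
  (0, 0, [::]).
- move=> a t [[c j] o]; rewrite /ok /= => -[-> lt_j]; split; last by split=> //; lia.
  apply: progresses_seq.
    by apply: runs_block; apply: free_other.
  rewrite /progresses /= -(upd_rrank _ _ _ _ _ j j.+1).
  set ptr := setp _ _ _.
  have := @runs_incr Sigma Gamma reg w width unit (fun=> rrank pointer) tt
    (layout n ptr 0 0 0 j) 0 (o ++ block j) (leq0n _).
  by rewrite ffunE /=; apply; lia.
- by split=> //=; rewrite addn0.
have foldE (s : seq (atom P w)) u : foldl (fun u b => eff b u) u s =
   (u.1.1, u.1.2 + size s, u.2 ++ flatten [seq block j | j <- iota u.1.2 (size s)]).
  elim: s u => [|b s IH] [[c j'] o'] /=; first by rewrite addn0 cats0.
  by rewrite IH /= addnS catA.
by rewrite foldE.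
Qed.

Lemma flatten_blocks :
  flatten [seq block j | j <- iota 0 (size L)] =
  pmap (fun a : atom P w => [pick g : Gamma | has_label a g])
     (sort (fun a b : atom P w => (a == b) || wrp_lt a b) (enum (selected P w))).
Proof.
rewrite /block /ranked (flatten_by_rank (wrp_lt_linear P w) (perm_all_atoms w P)).
  have : {subset sort (fun a b : atom P w => (a == b) || wrp_lt a b)
    (enum (selected P w)) <= selected P w}.
    by move=> a; rewrite mem_sort mem_enum.
  elim: (sort _ _) => //= a s IH sub; rewrite IH; last first.
    by move=> b b_s; apply: sub; rewrite inE b_s orbT.
  have [g [lab_g uniq_g]] := label_unique (sub a (mem_head _ _)).
  case: pickP => [g' /uniq_g <-|/(_ g)]; last by rewrite lab_g.
  suff -> : labels a = [:: g] by [].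
  rewrite /labels (eq_in_filter (a2 := pred1 g)) ?filter_pred1_uniq ?enum_uniq ?mem_enum //.
  by move=> h _; apply/idP/eqP => [/uniq_g//|->].
rewrite size_sort (perm_size (perm_all_atoms w P)) -!cardE; exact: max_card.
Qed.

Lemma runs_main : exists s i o,
  odflt o (wrp_map P w) = o /\
  runs w width main tt (layout n [ffun=> 0] 0 0 0 0) 0 [::]
    (wrp_map P w : bool) s i o.
Proof.
rewrite /wrp_map -flatten_blocks; have dom := @dom_ok [ffun=> 0] 0 0 [::].
case: ifP dom => dom_w dom.
  exists (layout n [ffun=> 0] 0 0 0 (size L)), 0; eexists; split; first by [].
  apply: runs_branch dom _.
  exact: (runs_seq runs_emit_all (runs_ret (fun=> true) _ (leq0n _))).
exists (layout n [ffun=> 0] 0 0 0 0), 0, [::]; split=> //.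
apply: runs_branch dom _; exact: (runs_ret (fun=> false)).
Qed.

End Correctness.

(** This bounds the number of rounds and the number of predecessors. *)
Lemma size_all_atoms w :
  size (all_atoms w P) <= #|copy P| * (size w).+1 ^ max_arity.
Proof.
rewrite (perm_size (perm_all_atoms w P)) -cardE card_tagged sumnE big_map.
rewrite big_enum /= -sum_nat_const; apply: leq_sum => c _.
rewrite card_ffun !card_ord; apply: (@leq_trans ((size w).+1 ^ arity c)).
  by case: (arity c) => // k; rewrite leq_exp2r.
by rewrite leq_pexp2l // (leq_bigmax (F := fun c : copy P => arity c)).
Qed.

End Presentation.

(** The constant [C] covers the linear needs of all deciders, the second term of [K]
    the number of atoms. *)
Lemma wrp_logspace (Sigma Gamma : finType) (P : wrp Sigma Gamma) :
  logspace_computable (wrp_map P).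
Proof.
pose X := pointer P.
have [Dsel sel_ok] := fin_all_exists (fun sc : 'I_3 * copy P =>
  log_decidable_mso Gamma (@slot _ _ P sc.1 sc.2) (sel_formula sc.2)).
have [Dlab lab_ok] := fin_all_exists (fun cg : copy P * Gamma =>
  log_decidable_mso Gamma (@slot _ _ P written cg.1) (lab_formula cg.1 cg.2)).
have [Dlt lt_ok] := fin_all_exists (fun cc : copy P * copy P =>
  log_decidable_wrp_lt (env_cat (@slot _ _ P compared cc.1)
                                (@slot _ _ P written cc.2))).
have no (T : Type) (i : 'I_0) : T by case: i.
have [Ddom dom_ok] := log_decidable_mso Gamma (no X) (dom_formula P).
pose C := (\max_sc (Dsel sc).2 + \max_cg (Dlab cg).2 + \max_cc (Dlt cc).2 +
           Ddom.2).+1.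
pose Q := main (fun s c => (Dsel (s, c)).1) (fun c g => (Dlab (c, g)).1)
               (fun c c' => (Dlt (c, c')).1) Ddom.1.
pose K := (C + 2 * 1) + (#|copy P| + 2 * max_arity P).
apply: (logspace_program (Q := Q) (K := K)) => w /=.
set l := maxn 1 _; have le_K K' : K' <= K -> 2 ^ (K' * l) <= 2 ^ (K * l).
  by move=> le_K'; rewrite leq_exp2l // leq_mul2r le_K' orbT.
have lt_C : C * (size w).+1 < 2 ^ (K * l).
  rewrite -[(size w).+1]expn1; apply: leq_trans (ltn_width _ _ _) (le_K _ _).
  exact: leq_addr.
have lt_L : size (all_atoms w P) < 2 ^ (K * l).
  apply: leq_ltn_trans (size_all_atoms P w) _.
  apply: leq_trans (ltn_width _ _ _) (le_K _ _); exact: leq_addl.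
have lt_le C' : C' <= C -> C' * (size w).+1 < 2 ^ (K * l).
  by move=> le_C; apply: leq_ltn_trans lt_C; rewrite leq_mul2r le_C orbT.
have lt_n : size w < 2 ^ (K * l).
  by apply: ltn_trans (lt_le 1 _) => //; rewrite mul1n.
split=> //; apply: runs_main lt_n lt_L.
- move=> s a ptr at_a c j o; rewrite inE.
  apply: (sel_ok (s, tag a) w _ (tagged a)) => //; apply: lt_le.
  have := leq_bigmax (F := fun sc => (Dsel sc).2) (s, tag a); rewrite /C /=; lia.
- move=> a g ptr at_a c j o.
  apply: (lab_ok (tag a, g) w _ (tagged a)) => //; apply: lt_le.
  have := leq_bigmax (F := fun cg => (Dlab cg).2) (tag a, g); rewrite /C /=; lia.
- move=> b a ptr at_b at_a c j o.
  have := lt_ok (tag b, tag a) w (K * l) (env_cat (tagged b) (tagged a)) ptr c j o.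
  rewrite atom_of_lpart atom_of_rpart; apply.
    apply: lt_le.
    have := leq_bigmax (F := fun cc => (Dlt cc).2) (tag b, tag a); rewrite /C /=; lia.
  move=> r; rewrite /env_cat; case: splitP => r' _; [exact: at_b|exact: at_a].
- move=> ptr c j o; apply: dom_ok => [|r]; last exact: (no _ r).
  by apply: lt_le; rewrite /C; lia.
Qed.

Theorem theorem4p13 :
  (forall (Sigma Gamma : finType) (T : seq Sigma -> option (seq Gamma)),
      is_wrp T -> logspace_computable T) /\
  (exists (Sigma Gamma : finType) (T : seq Sigma -> option (seq Gamma)),
      logspace_computable T /\ ~ is_wrp T).
Proof.
split=> [Sigma Gamma T [P TE]|].
  have [M [computesM spaceM]] := wrp_logspace P.
  by exists M; split=> // w; rewrite TE; apply: computesM.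
exists bool, bool, balanced_map.
by split; [exact: logspace_balanced_map|exact: balanced_map_not_wrp].
Qed.
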